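(* Let $n\ge2$ be an integer. Let $\Gamma$ be an unoriented planar $4$-valent graph containing, inside a disk, an empty bigon face: two distinct vertices $v,w$ joined by two edges bounding an empty disk, with two further (outer) ends at $v$ and two outer ends at $w$ leaving the disk. Let $\Gamma_{s}$ be obtained from $\Gamma$ by replacing the bigon with two disjoint arcs, one joining the two outer ends at $v$ and the other joining the two outer ends at $w$, and let $\Gamma_{x}$ be obtained by replacing (collapsing) the bigon with a single vertex to which the four outer ends are attached in the same cyclic order. Then $$\langle\!\langle\Gamma\rangle\!\rangle=([2n-3]+1)\,\langle\!\langle\Gamma_{s}\rangle\!\rangle+[2]\,\langle\!\langle\Gamma_{x}\rangle\!\rangle .$$
   Context: Throughout, $n\ge 2$ is an integer, $q$ is a formal variable, and $[m]=\frac{q^m-q^{-m}}{q-q^{-1}}$ for $m\in\mathbb Z$. Graphs. A planar $4$-valent graph is embedded in $\mathbb R^2$, considered up to planar isotopy; it may have loops, multiple edges, several components, and components that are circles without vertices. An orientation of all edges (and circles) is balanced if every vertex has two incoming and two outgoing edge-ends. A vertex is then crossing-type if in cyclic order the ends are in, in, out, out, and alternating if they are in, out, in, out. Local relations relate graphs that are identical outside a disk. MOY graph polynomial. For oriented planar $4$-valent graphs $\Gamma$ all of whose vertices are crossing-type, $R(\Gamma)\in\mathbb Z[q,q^{-1}]$ is the (well-defined, unique) planar-isotopy-invariant function with $R(\emptyset)=1$ and satisfying the following local relations. (i) A circle without vertices bounding an empty disk may be removed with factor $[n]$. (ii) A vertex having a loop edge that bounds an empty disk may be replaced by an arc with factor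 $[n-1]$. (iii) An empty bigon face whose two edges are both directed from one vertex to the other equals $[2]$ times the graph with the bigon collapsed to a single vertex. (iv) An empty bigon face with vertices $v,w$ and edges $v\to w$, $w\to v$ equals $G_1+[n-2]G_2$, where in $G_2$ the bigon is replaced by two arcs, one joining the two outer ends at $v$ and one joining the two outer ends at $w$, and in $G_1$ by the other two disjoint orientation-compatible arcs (each joining an outer end at $v$ to an outer end at $w$). (v) For three parallel, equally oriented strands, let $E_i$ ($i=1,2$) denote a vertex merging strands $i,i+1$; then $E_1E_2E_1+E_2=E_2E_1E_2+E_1$ (composition by stacking). (vi) Let the disk have six boundary points $p_1,\dots,p_6$ in cyclic order, alternately incoming and outgoing. Let $T$ be the triangle graph with directed-cycle triangular face whose three vertices carry outer ends $\{p_1,p_2\},\{p_3,p_4\},\{p_5,p_6\}$, and $T'$ the analogous one with $\{p_2,p_3\},\{p_4,p_5\},\{p_6,p_1\}$. Let $M$ be three disjoint arcs joining $p_1p_2,p_3p_4,p_5p_6$ and $M'$ three disjoint arcs joining $p_2p_3,p_4p_5,p_6p_1$. Then $T+[n-3]M'=T'+[n-3]M$. Bracket. For such $\Gamma$, $[\Gamma]=(q^{1-n})^{\mathrm{rot}(\Gamma)}R(\Gamma)$, where $\mathrm{rot}(\Gamma)$ is the sum over the disjoint oriented circles obtained by splicing each vertex according to orientation (into two non-crossing arcs, each from an incoming to an adjacent outgoing end) of $+1$ for each counterclockwise and $-1$ for each clockwise circle. For a balanced oriented graph with alternating vertices, $[\,\cdot\,]$ is extended by expanding each alternating vertex as $q$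 times the smoothing in which each incoming strand turns left, plus $q^{-1}$ times the smoothing in which each incoming strand turns right. Evaluation of unoriented graphs. For an unoriented planar $4$-valent graph $\Gamma$, $\langle\!\langle\Gamma\rangle\!\rangle=\sum_{o}[\Gamma^{o}]$, the sum over all balanced orientations $o$ of $\Gamma$. *)

(* Defs.v *)
From mathcomp Require Import all_boot all_order all_algebra.
From Stdlib Require Import Relation_Operators.

Set Implicit Arguments.
Unset Strict Implicit.
Unset Printing Implicit Defensive.

Import GRing.Theory.

(* MathComp has no Laurent polynomials: Z[q, 1/q] is the subring of the       *)
(* rational functions in q consisting of the p / q ^+ k with p in Z[q].       *)

Definition ratfun := {fraction {poly int}}.

Definition q : ratfun := tofrac 'X%R.

Definition laurent (f : ratfun) : Prop :=
  exists (p : {poly int}) (k : nat), (f = tofrac p / q ^+ k)%R.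

Definition qint (m : int) : ratfun := ((q ^ m - q ^ (- m)) / (q - q^-1))%R.

(* A planar 4-valent graph in generic position with respect to the height     *)
(* function is cut by horizontal lines into slices, each containing a single  *)
(* local minimum (Cup), local maximum (Cap) or vertex (Vert); a vertex has    *)
(* two of its ends below it and two above it (its other positions are         *)
(* obtained by bending ends with cups and caps).  The graph is the word of    *)
(* its slices, read upwards.  (k, i) has i strands on its left: a cup creates *)
(* the strands i and i+1 above it, a cap joins the strands i and i+1 below    *)
(* it, a vertex sits on the strands i and i+1.  Loops, multiple edges,        *)
(* several (possibly nested) components and vertex-free circles all occur.    *)

Inductive kind := Cup | Cap | Vert.

Definition slice := (kind * nat)%type.

Definition ins (k : kind) : nat := if k is Cup then 0 else 2.
Definition outs (k : kind) : nat := if k is Cap then 0 else 2.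

Definition width_step (m : nat) (x : slice) : option nat :=
  if x.2 + ins x.1 <= m then Some (m - ins x.1 + outs x.1) else None.

Fixpoint width_run (m : nat) (w : seq slice) : option nat :=
  if w is x :: w' then obind (width_run^~ w') (width_step m x) else Some m.

Definition planar_graph (w : seq slice) : bool := width_run 0 w == Some 0.

(* Planar isotopy: exchange of the heights of two slices side by side,        *)
(* creation or cancellation of a minimum with an adjacent maximum, and        *)
(* rotation of a vertex by a quarter turn, in either direction.               *)

Inductive isotopy_move : seq slice -> seq slice -> Prop :=
| move_exchange (k l : kind) (i j : nat) :
    isotopy_move [:: (k, i); (l, i + outs k + j)]
                 [:: (l, i + ins k + j); (k, i)]
| move_zigzagl (i : nat) :
    isotopy_move [:: (Cup, i); (Cap, i.+1)] [::]
| move_zigzagr (i : nat) :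
    isotopy_move [:: (Cup, i.+1); (Cap, i)] [::]
| move_rotatel (i : nat) :
    isotopy_move [:: (Cup, i.+2); (Vert, i.+1); (Cap, i)] [:: (Vert, i)]
| move_rotater (i : nat) :
    isotopy_move [:: (Cup, i); (Vert, i.+1); (Cap, i.+2)] [:: (Vert, i)].

Definition isotopy_step (w1 w2 : seq slice) : Prop :=
  exists a m1 m2 b : seq slice,
    [/\ w1 = a ++ m1 ++ b, w2 = a ++ m2 ++ b, isotopy_move m1 m2,
        planar_graph w1 & planar_graph w2].

Definition isotopic : seq slice -> seq slice -> Prop :=
  clos_refl_sym_trans (seq slice) isotopy_step.

(* Oriented graphs.  A strand crossing a horizontal line is directed upwards  *)
(* (true) or downwards (false).  OCup d creates a left strand of direction d  *)
(* and a right strand of direction ~~ d; OVert c d is a vertex whose top left *)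
(* and top right strands have directions c and d.                             *)

Inductive okind := OCup of bool | OCap | OVert of bool & bool.

Definition oslice := (okind * nat)%type.

Definition forget_kind (k : okind) : kind :=
  match k with OCup _ => Cup | OCap => Cap | OVert _ _ => Vert end.

Definition forget (w : seq oslice) : seq slice :=
  [seq (forget_kind x.1, x.2) | x <- w].

(* For a vertex with bottom directions a, b (left, right) and top directions  *)
(* c, d: which of its ends are incoming, in counterclockwise order from the   *)
(* bottom left one.                                                           *)
Definition incoming (a b c d : bool) : seq bool := [:: a; b; ~~ d; ~~ c].

Definition balanced (a b c d : bool) : bool :=
  count id (incoming a b c d) == 2.

Definition alternating (a b c d : bool) : bool :=
  (incoming a b c d == [:: true; false; true; false])
  || (incoming a b c d == [:: false; true; false; true]).

(* The directions of the strands above a slice, given those below it; None    *)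
(* when the directions do not fit or a vertex is not balanced.                *)
Definition orient_step (s : seq bool) (x : oslice) : option (seq bool) :=
  let: (k, i) := x in
  match k, drop i s with
  | OCup d, r => if i <= size s then Some (take i s ++ [:: d, ~~ d & r])
                 else None
  | OCap, [:: a, b & r] => if a != b then Some (take i s ++ r) else None
  | OVert c d, [:: a, b & r] =>
      if balanced a b c d then Some (take i s ++ [:: c, d & r]) else None
  | _, _ => None
  end.

Fixpoint orient_run (s : seq bool) (w : seq oslice) : option (seq bool) :=
  if w is x :: w' then obind (orient_run^~ w') (orient_step s x) else Some s.

Definition oriented_graph (w : seq oslice) : bool :=
  orient_run [::] w == Some [::].

Definition alternating_slice (s : seq bool) (x : oslice) : bool :=
  if x is (OVert c d, i) then
    alternating (nth false s i) (nth false s i.+1) c d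
  else false.

Fixpoint crossing_only (s : seq bool) (w : seq oslice) : bool :=
  if w is x :: w' then
    ~~ alternating_slice s x
    && (if orient_step s x is Some t then crossing_only t w' else true)
  else true.

(* Oriented graphs all of whose vertices are crossing-type. *)
Definition crossing_graph (w : seq oslice) : bool :=
  oriented_graph w && crossing_only [::] w.

(* An isotopy move carries the orientation along: outside of the move the     *)
(* orientations are the same, and this determines the orientations inside.    *)
Definition crossing_isotopy_step (w1 w2 : seq oslice) : Prop :=
  exists a m1 m2 b : seq oslice,
    [/\ w1 = a ++ m1 ++ b, w2 = a ++ m2 ++ b,
        isotopy_move (forget m1) (forget m2),
        orient_run [::] (a ++ m1) = orient_run [::] (a ++ m2) &
        crossing_graph w1 /\ crossing_graph w2].

(* The relations determining R.  In each of them the disk occupies some       *)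
(* consecutive slices, between a below and b above, with i strands on its     *)
(* left; asking the left-most graph to be a crossing-type graph fixes the     *)
(* directions of all the boundary strands of the disk, and then all graphs    *)
(* in the relation are crossing-type graphs.                                  *)
Record MOY_polynomial (n : nat) (R : seq oslice -> ratfun) : Prop := {
  moy_laurent : forall w, crossing_graph w -> laurent (R w);
  moy_isotopy : forall w1 w2, crossing_isotopy_step w1 w2 -> R w1 = R w2;
  moy_empty : R [::] = 1%R;
  moy_circle : forall a b i d,
    crossing_graph (a ++ [:: (OCup d, i); (OCap, i)] ++ b) ->
    (R (a ++ [:: (OCup d, i); (OCap, i)] ++ b) = qint n%:Z * R (a ++ b))%R;
  moy_loop_right : forall a b i d,
    let g := a ++ [:: (OCup d, i.+1); (OVert d d, i); (OCap, i.+1)] ++ b in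
    crossing_graph g -> (R g = qint (n%:Z - 1) * R (a ++ b))%R;
  moy_loop_left : forall a b i d,
    let g := a ++ [:: (OCup (~~ d), i); (OVert d d, i.+1); (OCap, i)] ++ b in
    crossing_graph g -> (R g = qint (n%:Z - 1) * R (a ++ b))%R;
  moy_bigon_parallel : forall a b i d,
    let g := a ++ [:: (OVert d d, i); (OVert d d, i)] ++ b in
    crossing_graph g -> (R g = qint 2 * R (a ++ [:: (OVert d d, i)] ++ b))%R;
  moy_bigon_antiparallel : forall a b i d,
    let g := a ++ [:: (OVert d (~~ d), i); (OVert (~~ d) d, i)] ++ b in
    crossing_graph g ->
    (R g = R (a ++ b)
           + qint (n%:Z - 2) * R (a ++ [:: (OCap, i); (OCup (~~ d), i)] ++ b))%R;
  moy_three_strands : forall a b i d,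
    let E1 := (OVert d d, i) in
    let E2 := (OVert d d, i.+1) in
    crossing_graph (a ++ [:: E1; E2; E1] ++ b) ->
    (R (a ++ [:: E1; E2; E1] ++ b) + R (a ++ [:: E2] ++ b)
     = R (a ++ [:: E2; E1; E2] ++ b) + R (a ++ [:: E1] ++ b))%R;
  (* The boundary strands have directions d, ~~ d, d below and above; the     *)
  (* boundary points p1, ..., p6 are the three bottom ones from left to right *)
  (* followed by the three top ones from right to left.                       *)
  moy_triangle : forall a b i d,
    let T := [:: (OVert (~~ d) d, i); (OVert d d, i.+1);
                 (OVert d (~~ d), i)] in
    let T' := [:: (OVert d (~~ d), i.+1); (OVert d d, i);
                  (OVert (~~ d) d, i.+1)] in
    let M := [:: (OCap, i); (OCup d, i)] in
    let M' := [:: (OCap, i.+1); (OCup (~~ d), i.+1)] in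
    crossing_graph (a ++ T ++ b) ->
    (R (a ++ T ++ b) + qint (n%:Z - 3) * R (a ++ M' ++ b)
     = R (a ++ T' ++ b) + qint (n%:Z - 3) * R (a ++ M ++ b))%R
}.

(* A crossing-type vertex is spliced vertically when its top strands (hence   *)
(* its bottom strands) are parallel, and horizontally otherwise.              *)
Definition splice (w : seq oslice) : seq oslice :=
  flatten [seq (if x is (OVert c d, i) then
                  if c == d then [::] else [:: (OCap, i); (OCup c, i)]
                else [:: x]) | x <- w].

(* For a vertex-free graph, the number of counterclockwise circles minus the  *)
(* number of clockwise ones.  s lists the strands with their directions and   *)
(* labels, two strands having the same label when they are joined below; k    *)
(* is a fresh label.  A cap whose two strands are already joined is the       *)
(* highest point of its circle, which is clockwise exactly when it is         *)
(* traversed from left to right there.                                        *)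
Fixpoint circles_rot (k : nat) (s : seq (nat * bool)) (w : seq oslice) : int :=
  match w with
  | [::] => 0%R
  | (OCup d, i) :: w' =>
      circles_rot k.+1 (take i s ++ [:: (k, d), (k, ~~ d) & drop i s]) w'
  | (OCap, i) :: w' =>
      if drop i s is [:: (l1, d1), (l2, d2) & r] then
        let s' := take i s ++ r in
        if l1 == l2 then
          ((if d1 then -1 else 1) + circles_rot k s' w')%R
        else
          circles_rot k [seq (if x.1 == l2 then l1 else x.1, x.2) | x <- s'] w'
      else 0%R
  | (OVert _ _, _) :: w' => circles_rot k s w'
  end.

Definition rotnum (w : seq oslice) : int := circles_rot 0 [::] (splice w).

Definition crossing_bracket (n : nat) (R : seq oslice -> ratfun)
    (w : seq oslice) : ratfun :=
  ((q ^ (1 - n%:Z)) ^ rotnum w * R w)%R.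

(* An alternating vertex on the strands i, i+1 has, below and above, a left   *)
(* strand of direction d and a right strand of direction ~~ d.  If d is       *)
(* upwards, the incoming ends are the bottom left and top right ones, and     *)
(* turning left leads to the top left and bottom right ones respectively; if  *)
(* d is downwards, the incoming ends are the bottom right and top left ones,  *)
(* and turning left leads to the bottom left and top right ones.              *)
Definition smooth_left (d : bool) (i : nat) : seq oslice :=
  if d then [::] else [:: (OCap, i); (OCup d, i)].
Definition smooth_right (d : bool) (i : nat) : seq oslice :=
  if d then [:: (OCap, i); (OCup d, i)] else [::].

(* The crossing-type graphs obtained by smoothing all alternating vertices,   *)
(* each with the exponent of its coefficient; s lists the directions of the   *)
(* strands below w.                                                           *)
Fixpoint smoothings (s : seq bool) (w : seq oslice) : seq (int * seq oslice) :=
  if w is x :: w' then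
    let rest := if orient_step s x is Some t then smoothings t w' else [::] in
    if alternating_slice s x then
      if x is (OVert d _, i) then
        [seq (e.1 + 1, smooth_left d i ++ e.2)%R | e <- rest]
        ++ [seq (e.1 - 1, smooth_right d i ++ e.2)%R | e <- rest]
      else [::]
    else [seq (e.1, x :: e.2) | e <- rest]
  else [:: (0%R, [::])].

Definition bracket (n : nat) (R : seq oslice -> ratfun)
    (w : seq oslice) : ratfun :=
  (\sum_(e <- smoothings [::] w) q ^ e.1 * crossing_bracket n R e.2)%R.

Definition okinds (k : kind) : seq okind :=
  match k with
  | Cup => [:: OCup true; OCup false]
  | Cap => [:: OCap]
  | Vert => [:: OVert true true; OVert true false;
                OVert false true; OVert false false]
  end.

Fixpoint labelings (w : seq slice) : seq (seq oslice) :=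
  if w is x :: w' then
    [seq (k, x.2) :: o | k <- okinds x.1, o <- labelings w']
  else [:: [::]].

(* The balanced orientations of a graph, each listed once. *)
Definition orientations (w : seq slice) : seq (seq oslice) :=
  [seq o <- labelings w | oriented_graph o].

Definition evaluation (n : nat) (R : seq oslice -> ratfun)
    (w : seq slice) : ratfun :=
  (\sum_(o <- orientations w) bracket n R o)%R.

(* Main.v *)
Require Import Defs.
From HB Require Import structures.
From mathcomp Require Import all_boot all_order all_algebra.
From mathcomp Require Import ring zify.

Set Implicit Arguments.
Unset Strict Implicit.
Unset Printing Implicit Defensive.

Import GRing.Theory.

(**
  The identity is local: everything happens inside the disk of the bigon, once
  the evaluation is known to be a sum of local contributions.

  Locality.  Choosing a balanced orientation and then a smoothing of each
  alternating vertex amounts to an independent choice at each slice, given the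
  directions of the strands below it.  So the evaluation is a sum over
  [states], and cutting a graph along a disk cuts the sum ([evaluation_disk]).
  A linear relation between the sums over the inside of the disk that holds
  for all directions of the boundary strands, and for all crossing-type
  outsides, is then a relation between evaluations ([local_relation]).

  Rotation numbers.  The factor of the rotation number looks global, but twice
  the rotation number is the sum over all maxima and minima of a sign that
  depends only on the direction of the strands there ([rotnum_turning]); a
  crossing-type vertex contributes nothing.  Hence replacing the inside of a
  disk changes the rotation number by an amount that is visible in the disk
  ([rotnum_disk]).

  Isotopy invariance.  For each isotopy move and all boundary directions, the
  states on both sides can be paired so that paired states have the same
  exponent, the same turning, and isotopic crossing-type graphs
  ([zigzagl_match], [rotatel_match], [tangle_sum_exchange]).  When the rotated
  vertex is alternating, its two smoothings straighten out by zigzags or by an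
  exchange of heights.

  The bigon.  By [evaluation_isotopic] the three graphs may be taken to agree
  outside two slices.  Let d be the direction of the lower left end.
  - If both lower ends have direction d, then so have all the ends and inner
    edges, and the relation is the parallel bigon relation
    ([bigon_parallel]).
  - If the ends have directions d, ~~ d below and above, the inner edges are
    oriented in two ways.  One makes both vertices alternating, and smoothing
    them yields the two arc diagrams and one with a circle; the other is an
    antiparallel bigon ([bigon_smoothing]).
  - If the ends have directions d, ~~ d below and ~~ d, d above, exactly one
    vertex is alternating.  One of its smoothings gives the single vertex, the
    other a vertex with a loop ([bigon_crossing]).
  Evaluating circles and loops, with their rotation numbers, leaves identities
  between quantum integers ([circle_coefficient], [loop_coefficient]).  For
  all other boundary directions both sides vanish.
*)

(** * Oriented tangles and their turning *)

(** The word of a tangle that has i strands on its left. *)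
Definition embed (T : Type) (i : nat) (w : seq (T * nat)) : seq (T * nat) :=
  [seq (x.1, i + x.2) | x <- w].

(** Directed tangles all of whose vertices are crossing-type; the crossing-type
    graphs are those from [::] to [::]. *)
Definition tangle (s : seq bool) (w : seq oslice) (t : seq bool) : bool :=
  (orient_run s w == Some t) && crossing_only s w.

(** Half turns are counted with sign: a maximum or a minimum whose left strand
    goes up is traversed clockwise. *)
Definition twist (d : bool) : int := if d then (-1)%R else 1%R.

Definition slice_turning (s : seq bool) (x : oslice) : int :=
  match x with
  | (OCup d, _) => twist d
  | (OCap, i) => twist (nth false s i)
  | _ => 0%R
  end.

(** Vertices count for zero: a crossing-type vertex is spliced either into two
    monotone arcs or into a maximum and a minimum that turn oppositely. *)
Fixpoint turning (s : seq bool) (w : seq oslice) : int :=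
  if w is x :: w' then
    (slice_turning s x
     + (if orient_step s x is Some t then turning t w' else 0))%R
  else 0%R.

Lemma embed_cat (T : Type) i (w1 w2 : seq (T * nat)) :
  embed i (w1 ++ w2) = embed i w1 ++ embed i w2.
Proof. exact: map_cat. Qed.

Lemma embed_embed (T : Type) i j (w : seq (T * nat)) :
  embed i (embed j w) = embed (i + j) w.
Proof. by rewrite /embed -map_comp; apply: eq_map => -[k h] /=; rewrite addnA. Qed.

Lemma embed0 (T : Type) (w : seq (T * nat)) : embed 0 w = w.
Proof. by rewrite /embed -[RHS]map_id; apply: eq_map => -[k h]. Qed.

Lemma twistN d : (twist (~~ d) = - twist d)%R.
Proof. by case: d. Qed.

Lemma drop_ge2 (T : Type) i (s : seq T) : i + 2 <= size s ->
  exists a b r, drop i s = [:: a, b & r].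
Proof.
move=> h; have: 2 <= size (drop i s) by rewrite size_drop; lia.
by case: (drop i s) => [|a [|b r]] // _; exists a, b, r.
Qed.

#[local] Arguments orient_step : simpl never.

Lemma orient_step_fits s x t :
  orient_step s x = Some t -> x.2 + ins (forget_kind x.1) <= size s.
Proof.
case: x => -[d||c d] i; rewrite /orient_step /=.
  by case: ifP => //; rewrite addn0.
all: case E: (drop i s) => [|a [|b r]] // _.
all: by have := size_drop i s; rewrite E /=; lia.
Qed.

Lemma orient_step_size s x t : orient_step s x = Some t ->
  size t = size s - ins (forget_kind x.1) + outs (forget_kind x.1).
Proof.
move=> h; have := orient_step_fits h; case: x h => -[d||c d] i; rewrite /orient_step /=.
- move=> + h; have hi : i <= size s by lia.
  by rewrite hi => -[<-]; rewrite size_cat /= size_takel // size_drop; lia.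
all: move=> + h; have [a [b [r E]]] := drop_ge2 h; rewrite E.
all: case: ifP => // _ [<-]; rewrite size_cat /= size_takel; last by lia.
all: by have := size_drop i s; rewrite E /=; lia.
Qed.

Lemma orient_step_frame l r s x : x.2 + ins (forget_kind x.1) <= size s ->
  orient_step (l ++ s ++ r) (x.1, size l + x.2)
  = omap (fun t => l ++ t ++ r) (orient_step s x).
Proof.
case: x => k i /= h.
have hi : i <= size s by apply: leq_trans h; apply: leq_addr.
have Ed : drop (size l + i) (l ++ s ++ r) = drop i s ++ r.
  rewrite drop_cat ltnNge leq_addr /= addKn drop_cat.
  by case: ltngtP hi => // ->; rewrite subnn drop0 drop_size.
have Et : take (size l + i) (l ++ s ++ r) = l ++ take i s.
  rewrite take_cat ltnNge leq_addr /= addKn take_cat.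
  by case: ltngtP hi => // ->; rewrite subnn take0 take_size cats0.
rewrite /orient_step Ed Et !size_cat.
case: k h => [d||c d] /= h.
- by rewrite hi leq_add2l (leq_trans hi) ?leq_addr //= -!catA.
- have [a [b [u ->]]] := drop_ge2 h => /=.
  by case: ifP => //= _; rewrite -!catA.
- have [a [b [u ->]]] := drop_ge2 h => /=.
  by case: ifP => //= _; rewrite -!catA.
Qed.

Lemma nth_frame l (s r : seq bool) i : i < size s ->
  nth false (l ++ s ++ r) (size l + i) = nth false s i.
Proof.
by move=> h; rewrite nth_cat ltnNge leq_addr /= addKn nth_cat h.
Qed.

Lemma alternating_slice_frame l r s x : x.2 + ins (forget_kind x.1) <= size s ->
  alternating_slice (l ++ s ++ r) (x.1, size l + x.2) = alternating_slice s x.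
Proof.
case: x => -[d||c d] i //= h.
by rewrite -addnS !nth_frame //; lia.
Qed.

Lemma tangle_nil s t : tangle s [::] t = (s == t).
Proof. by rewrite /tangle /= andbT. Qed.

Lemma tangle_cons s x w t : tangle s (x :: w) t =
  ~~ alternating_slice s x
  && (if orient_step s x is Some u then tangle u w t else false).
Proof.
rewrite /tangle /=; case: (orient_step s x) => [u|] /=; last by rewrite andbF.
by rewrite andbCA.
Qed.

Lemma tangle_orient s w t : tangle s w t -> orient_run s w = Some t.
Proof. by case/andP => /eqP. Qed.

Lemma orient_run_cat s w1 w2 :
  orient_run s (w1 ++ w2) = obind (orient_run^~ w2) (orient_run s w1).
Proof. by elim: w1 s => [|x w1 IH] s //=; case: (orient_step s x). Qed.

Lemma tangle_cat s w1 t w2 u :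
  tangle s w1 t -> tangle s (w1 ++ w2) u = tangle t w2 u.
Proof.
elim: w1 s => [|x w1 IH] s /=; first by rewrite tangle_nil => /eqP ->.
rewrite !tangle_cons => /andP[-> /=].
by case: (orient_step s x) => // v; apply: IH.
Qed.

Lemma tangle_catP s w1 w2 u : tangle s (w1 ++ w2) u ->
  exists2 t, tangle s w1 t & tangle t w2 u.
Proof.
elim: w1 s => [|x w1 IH] s /=; first by exists s; rewrite ?tangle_nil.
rewrite tangle_cons; case E: (orient_step s x) => [v|] /andP[alt] // /IH[t h1 h2].
by exists t => //; rewrite tangle_cons alt E.
Qed.

(** Strands placed on either side of a tangle do not interact with it; this is
    what makes the directions of the boundary strands of a disk the only
    information shared by its inside and its outside. *)
Lemma tangle_frame l r s w t :
  tangle s w t -> tangle (l ++ s ++ r) (embed (size l) w) (l ++ t ++ r).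
Proof.
elim: w s => [|x w IH] s /=; first by rewrite !tangle_nil => /eqP ->.
rewrite !tangle_cons; case E: (orient_step s x) => [u|] /andP[alt] // h.
have fit := orient_step_fits E.
by rewrite alternating_slice_frame // alt orient_step_frame // E /= IH.
Qed.

Lemma turning_cat s w1 t w2 : tangle s w1 t ->
  turning s (w1 ++ w2) = (turning s w1 + turning t w2)%R.
Proof.
elim: w1 s => [|x w1 IH] s /=; first by rewrite tangle_nil add0r => /eqP ->.
rewrite tangle_cons => /andP[_]; case: (orient_step s x) => // u /IH ->.
by rewrite addrA.
Qed.

Lemma turning_frame l r s w t : tangle s w t ->
  turning (l ++ s ++ r) (embed (size l) w) = turning s w.
Proof.
elim: w s => [|x w IH] s //=.
rewrite tangle_cons; case E: (orient_step s x) => [u|] /andP[_] // h.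
have fit := orient_step_fits E.
rewrite orient_step_frame // E /= IH //; congr (_ + _)%R.
case: x {E} fit => -[d||c d] i //= fit.
by rewrite nth_frame //; lia.
Qed.

(** * The rotation number as a sum of local turnings *)

(** The invariant of the circle count: the strands below a horizontal line are
    joined in pairs by arcs lying below it, which do not cross, so that some
    innermost arc has adjacent ends and can be removed.  The integer is the
    total turning of the arcs: whatever its shape, an embedded arc turns as
    much as a single minimum with the same ends would. *)
Inductive arcs : seq (nat * bool) -> int -> Prop :=
| arcs_nil : arcs [::] 0%R
| arcs_insert s1 s2 l d t :
    arcs (s1 ++ s2) t -> l \notin unzip1 (s1 ++ s2) ->
    arcs (s1 ++ [:: (l, d), (l, ~~ d) & s2]) (t + twist d)%R.

Definition relabel (f : nat -> nat) (s : seq (nat * bool)) :=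
  [seq (f x.1, x.2) | x <- s].

Lemma unzip1_relabel f s : unzip1 (relabel f s) = map f (unzip1 s).
Proof. by rewrite /unzip1 -!map_comp. Qed.

Lemma unzip2_relabel f s : unzip2 (relabel f s) = unzip2 s.
Proof. by rewrite /unzip2 -map_comp. Qed.

Lemma relabel_cat f s1 s2 : relabel f (s1 ++ s2) = relabel f s1 ++ relabel f s2.
Proof. exact: map_cat. Qed.

Lemma relabel_id f s : {in unzip1 s, f =1 id} -> relabel f s = s.
Proof.
elim: s => //= -[l d] s IH /= h; rewrite IH ?h ?mem_head // => x xs.
by apply: h; rewrite inE xs orbT.
Qed.

Lemma arcs_relabel f s t :
  arcs s t -> {in unzip1 s &, injective f} -> arcs (relabel f s) t.
Proof.
move=> h; elim: h f => {s t} [|s1 s2 l d t h IH ll] f finj; first exact: arcs_nil.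
have sub : {subset unzip1 (s1 ++ s2)
            <= unzip1 (s1 ++ [:: (l, d), (l, ~~ d) & s2])}.
  move=> x; rewrite /unzip1 !map_cat !mem_cat /= !inE.
  by case/orP => ->; rewrite ?orbT.
rewrite relabel_cat /=; apply: arcs_insert.
  by rewrite -relabel_cat; apply: IH => x y /sub xs /sub ys; apply: finj.
rewrite -relabel_cat unzip1_relabel; apply/mapP => -[x xs E].
have lin : l \in unzip1 (s1 ++ [:: (l, d), (l, ~~ d) & s2]).
  by rewrite /unzip1 map_cat mem_cat /= !inE eqxx !orbT.
by move: ll; rewrite (finj _ _ lin (sub _ xs) E) xs.
Qed.

Definition merge_label (l1 l2 l : nat) : nat := if l == l2 then l1 else l.

Lemma cat_cons2_eq (T : Type) (s1 s2 u1 u2 : seq T) (x y a b : T) :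
  s1 ++ [:: x, y & s2] = u1 ++ [:: a, b & u2] ->
  (exists m, u1 = s1 ++ [:: x, y & m] /\ s2 = m ++ [:: a, b & u2])
  \/ (exists m, s1 = u1 ++ [:: a, b & m] /\ u2 = m ++ [:: x, y & s2])
  \/ [\/ [/\ u1 = s1 ++ [:: x], y = a & s2 = b :: u2],
         [/\ s1 = u1, x = a, y = b & s2 = u2] |
         [/\ s1 = u1 ++ [:: a], x = b & u2 = y :: s2] ].
Proof.
elim: s1 u1 => [|c s1 IH] [|e u1] /=.
- by case=> -> -> ->; do 2 right; constructor 2.
- case: u1 => [|e' u1] /=; first by case=> -> -> ->; do 2 right; constructor 1.
  by case=> -> -> ->; left; exists u1.
- case: s1 IH => [|c' s1] _ /=; first by case=> -> -> <-; do 2 right; constructor 3.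
  by case=> -> -> <-; right; left; exists s1.
- case=> <- /IH [[m [-> ->]]|[[m [-> ->]]|[[-> -> ->]|[-> -> -> ->]|[-> -> ->]]]].
  + by left; exists m.
  + by right; left; exists m.
  + by do 2 right; constructor 1.
  + by do 2 right; constructor 2.
  + by do 2 right; constructor 3.
Qed.

(** A maximum either closes an arc or joins two arcs.  As arcs are removed from
    the inside outwards, the maximum meets an arc with adjacent ends at some
    point.  Either it closes this arc, or it only moves one end of another arc
    to the far end of this one, and then the turnings of the maximum and of
    the removed arc cancel. *)
Lemma arcs_cap s1 s2 x y t :
  arcs (s1 ++ [:: x, y & s2]) t -> x.2 != y.2 ->
  if x.1 == y.1 then arcs (s1 ++ s2) (t - twist x.2)%R
  else arcs (relabel (merge_label x.1 y.1) (s1 ++ s2)) (t + twist x.2)%R.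
Proof.
move E: (s1 ++ [:: x, y & s2]) => s h.
elim: h s1 s2 E => {s t} [|u1 u2 l d t h IH fresh] s1 s2; first by case: s1.
case: x y IH => [l1 d1] [l2 d2] /= IH.
(* The maximum is away from the arc removed, so both orders of removal agree. *)
have far (m1 m2 : seq (nat * bool)) :
    (forall r1 r2, r1 ++ [:: (l1, d1), (l2, d2) & r2] = u1 ++ u2 ->
      s1 ++ s2 = m1 ++ [:: (l, d), (l, ~~ d) & m2] -> r1 ++ r2 = m1 ++ m2 ->
      d1 != d2 ->
      if l1 == l2 then arcs (s1 ++ s2) (t + twist d - twist d1)%R
      else arcs (relabel (merge_label l1 l2) (s1 ++ s2))
                (t + twist d + twist d1)%R).
  move=> r1 r2 Eu -> Er /(IH _ _ Eu).
  have sub : {subset unzip1 (m1 ++ m2) <= unzip1 (u1 ++ u2)}.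
    move=> z; rewrite -Er -Eu /unzip1 !map_cat !mem_cat /= !inE.
    by case/orP => ->; rewrite ?orbT.
  have lm : l \notin unzip1 (m1 ++ m2) by apply: contra fresh; apply: sub.
  have [nl1 nl2] : l != l1 /\ l != l2.
    by split; apply: contraNneq fresh => ->;
       rewrite -Eu /unzip1 map_cat mem_cat /= !inE eqxx !orbT.
  case: ifP => _ hr.
    rewrite addrAC; apply: arcs_insert => //; by rewrite -Er.
  rewrite addrAC relabel_cat /= /merge_label (negPf nl2).
  apply: arcs_insert; first by rewrite -relabel_cat -Er.
  rewrite -relabel_cat unzip1_relabel; apply/mapP => -[z zs].
  case: ifP => _ E; first by rewrite E eqxx in nl1.
  by rewrite E zs in lm.
move=> eq_s; case: (cat_cons2_eq eq_s) => [[m [Eu Es]]|[[m [Es Eu]]|]].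
- by apply: (far (s1 ++ m) u2 s1 (m ++ u2)); rewrite ?Eu ?Es -?catA.
- apply: (far u1 (m ++ s2) (u1 ++ m) s2); rewrite ?Eu ?Es -?catA //=.
case.
- case=> Eu [? ?] Es dd; subst u1 s2 l2 d2.
  move: fresh; rewrite /unzip1 !map_cat !mem_cat /= !inE !negb_or -!andbA.
  case/and3P => f1 f2 f3.
  rewrite eq_sym (negPf f2) relabel_cat /= {2}/merge_label eqxx.
  have -> : d = ~~ d1 by case: (d) (d1) dd => [] [].
  rewrite negbK twistN addrNK.
  have keep u : l \notin unzip1 u -> relabel (merge_label l1 l) u = u.
    move=> lu; apply: relabel_id => z zu; rewrite /merge_label.
    by case: eqP => // zl; rewrite -zl zu in lu.
  by rewrite !keep //; move: h; rewrite -catA.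
- by case=> -> [-> ->] [-> ->] -> _; rewrite eqxx addrK.
- case=> -> [? ?] Eu dd; subst l1 d1 u2.
  have {dd}dd : d2 = d by case: (d) (d2) dd => [] [].
  subst d2; move: fresh.
  rewrite /unzip1 map_cat mem_cat /= inE !negb_or => /and3P[f1 f2 f3].
  rewrite (negPf f2) twistN addrK -catA /=.
  have -> : relabel (merge_label l l2) (u1 ++ (l, d) :: s2)
            = relabel (merge_label l l2) (u1 ++ (l2, d) :: s2).
    by rewrite !relabel_cat /= /merge_label eqxx (negPf f2).
  apply: arcs_relabel => // z z'.
  rewrite /unzip1 map_cat /= !mem_cat !inE /merge_label => hz hz'.
  case: eqP => [->|n1]; case: eqP => [->|n2] // E.
    by move: hz'; rewrite -E; case/or3P => [H|/eqP H|H];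
       rewrite ?H ?eqxx in f1 f2 f3.
  by move: hz; rewrite E; case/or3P => [H|/eqP H|H];
       rewrite ?H ?eqxx in f1 f2 f3.
Qed.

(** Reduces a claim on a slice at any position to a check on the directions of
    at most four strands. *)
Lemma tangle_slice s k i t : tangle s [:: (k, i)] t ->
  exists l x y r, [/\ s = l ++ x ++ r, t = l ++ y ++ r & size l = i]
    /\ [/\ tangle x [:: (k, 0)] y, size x = ins (forget_kind k)
         & size y = outs (forget_kind k)].
Proof.
rewrite tangle_cons; case E: (orient_step s _) => [u|] /andP[alt] //.
rewrite tangle_nil => /eqP eut; subst u; have /= fit := orient_step_fits E.
pose l := take i s; pose x := take (ins (forget_kind k)) (drop i s).
pose r := drop (ins (forget_kind k)) (drop i s).
have sl : size l = i by rewrite size_takel //; lia.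
have sx : size x = ins (forget_kind k) by rewrite size_takel // size_drop; lia.
have es : s = l ++ x ++ r by rewrite /l /x /r !cat_take_drop.
have fit0 : 0 + ins (forget_kind k) <= size x by rewrite sx.
move: E alt; rewrite es -(addn0 i) -sl.
rewrite (@orient_step_frame l r x (k, 0)) //.
rewrite (@alternating_slice_frame l r x (k, 0)) //.
case E: (orient_step x (k, 0)) => [y|] //= [<-] alt.
exists l, x, y, r; split; split; rewrite ?addn0 //.
  by rewrite tangle_cons alt E tangle_nil eqxx.
by rewrite (orient_step_size E) /= sx subnn.
Qed.

Definition vertex_free (w : seq oslice) : bool :=
  all (fun x => if x is (OVert _ _, _) then false else true) w.

Lemma splice_cat w1 w2 : splice (w1 ++ w2) = splice w1 ++ splice w2.
Proof. by rewrite /splice map_cat flatten_cat. Qed.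

Lemma splice_embed i w : splice (embed i w) = embed i (splice w).
Proof.
elim: w => //= x w IH; rewrite /splice /= -/(splice _) IH embed_cat; congr (_ ++ _).
by case: x => -[d||c d] j //=; case: (c == d).
Qed.

(** A vertex spliced horizontally becomes a maximum followed by a minimum that
    turn in opposite senses, so splicing does not change the total turning. *)
Lemma splice_tangle s w t : tangle s w t ->
  [/\ tangle s (splice w) t, turning s (splice w) = turning s w
    & vertex_free (splice w)].
Proof.
elim: w s => [|[k i] w IH] s.
  by rewrite tangle_nil => /eqP <-; split=> //; rewrite /splice /= tangle_nil.
rewrite -cat1s => /tangle_catP[u h1 h2]; have [p2 t2 v2] := IH _ h2.
suff [p1 t1 v1] : [/\ tangle s (splice [:: (k, i)]) u,
    turning s (splice [:: (k, i)]) = turning s [:: (k, i)]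
    & vertex_free (splice [:: (k, i)])].
  rewrite splice_cat (tangle_cat _ _ p1) (turning_cat _ p1) (turning_cat _ h1).
  by rewrite t1 t2 /vertex_free all_cat; split=> //; apply/andP.
have [l [x [y [r [[-> -> <-] [hp sx sy]]]]]] := tangle_slice h1.
have -> : [:: (k, size l)] = embed (size l) [:: (k, 0)].
  by rewrite /embed /= addn0.
rewrite splice_embed.
suff [p0 t0 v0] : [/\ tangle x (splice [:: (k, 0)]) y,
    turning x (splice [:: (k, 0)]) = turning x [:: (k, 0)]
    & vertex_free (splice [:: (k, 0)])].
  split; first exact: tangle_frame.
    by rewrite !(turning_frame _ _ (t := y)).
  by rewrite /vertex_free all_map; apply: sub_all v0 => -[[]].
move: x y hp sx sy {h1 h2} => x y.
case: k => [d||c d].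
- by move=> hp sx sy.
- by move=> hp sx sy.
- case: x => [|a [|b [|]]] // h _; case: y h => [|e [|f [|]]] //.
  by case: a; case: b; case: c; case: d; case: e; case: f.
Qed.

(** Each circle is counted at its highest point, where its two strands are the
    ends of one arc.  The arc and the maximum have the same turning there, so
    that the circle contributes twice the sign recorded by [circles_rot]. *)
Lemma circles_rot_turning k s t w : arcs s t -> all (gtn k) (unzip1 s) ->
  vertex_free w -> orient_run (unzip2 s) w = Some [::] ->
  (circles_rot k s w *+ 2 = t + turning (unzip2 s) w)%R.
Proof.
elim: w k s t => [|[[d||c d] i] w IH] k s t hs small //=.
- move=> _ []; case: s hs {small} => // hs _.
  have t0 s' : arcs s' t -> s' = [::] -> t = 0%R by case=> // -[].
  by rewrite (t0 _ hs) // mul0rn addr0.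
- move=> free; rewrite /orient_step /=; case: ifP => // fit /=.
  rewrite size_map in fit.
  pose s' := take i s ++ [:: (k, d), (k, ~~ d) & drop i s].
  have -> : take i (unzip2 s) ++ [:: d, ~~ d & drop i (unzip2 s)] = unzip2 s'.
    by rewrite /unzip2 map_cat /= map_take map_drop.
  move=> run; rewrite (IH _ _ (t + twist d)%R) //.
  + by rewrite -addrA.
  + apply: arcs_insert; rewrite cat_take_drop //.
    by apply/negP => /(allP small) /=; rewrite ltnn.
  + move: small; rewrite -{1}(cat_take_drop i s) /unzip1 !map_cat !all_cat /=.
    case/andP => h1 h2; rewrite ltnSn /=.
    by apply/andP; split; [apply: sub_all h1 | apply: sub_all h2] => z /= /ltnW.
- move=> free; rewrite /orient_step /= /unzip2 -map_drop -map_take.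
  case E: (drop i s) => [|[l1 d1] [|[l2 d2] r]] //=; case: ifP => // dd /= run.
  have es : s = take i s ++ [:: (l1, d1), (l2, d2) & r].
    by rewrite -E cat_take_drop.
  have fit : i < size s.
    by rewrite ltnNge; apply/negP => /drop_oversize; rewrite E.
  have -> : nth false (map snd s) i = d1.
    rewrite (nth_map (0, false)) // es nth_cat size_takel; last exact: ltnW.
    by rewrite ltnn subnn.
  have er : [seq x.2 | x <- take i s] ++ [seq x.2 | x <- r]
            = unzip2 (take i s ++ r) by rewrite /unzip2 map_cat.
  rewrite er in run *; move: (hs); rewrite {1}es => /arcs_cap /(_ dd) /=.
  have small' : all (gtn k) (unzip1 (take i s ++ r)).
    apply/allP => z zs; apply: (allP small).
    move: zs; rewrite {2}es /unzip1 !map_cat !mem_cat /= !inE.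
    by case/orP => ->; rewrite ?orbT.
  case: eqP => l12 har.
    rewrite mulrnDl (IH _ _ _ har) //.
    by rewrite /twist; case: (d1); ring.
  have -> : [seq (if x.1 == l2 then l1 else x.1, x.2) | x <- take i s ++ r]
     = relabel (merge_label l1 l2) (take i s ++ r) by [].
  rewrite (IH _ _ _ har) ?unzip2_relabel //; first by rewrite addrA.
  rewrite unzip1_relabel all_map; apply: sub_all small' => z /=.
  rewrite /merge_label; case: eqP => // _ _; apply: (allP small).
  by rewrite es /unzip1 map_cat mem_cat /= !inE eqxx orbT.
Qed.

(** The local formula for the rotation number: a circle makes one full turn,
    that is two half turns. *)
Lemma rotnum_turning w : tangle [::] w [::] -> (rotnum w *+ 2 = turning [::] w)%R.
Proof.
case/splice_tangle => p <- v; rewrite /rotnum.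
by rewrite (circles_rot_turning arcs_nil) ?add0r ?(tangle_orient p).
Qed.

(** * The evaluation as a sum over states *)

(** An encoding that provides a decidable equality on [okind], hence a
    membership predicate for lists of states. *)
Definition okind_code (k : okind) : option (bool + bool * bool) :=
  match k with
  | OCup d => Some (inl d) | OCap => None | OVert c d => Some (inr (c, d))
  end.

Definition okind_decode (u : option (bool + bool * bool)) : okind :=
  match u with
  | Some (inl d) => OCup d | None => OCap | Some (inr (c, d)) => OVert c d
  end.

Lemma okind_codeK : cancel okind_code okind_decode.
Proof. by case. Qed.

HB.instance Definition _ := Equality.copy okind (can_type okind_codeK).

(** The directions of the top strands, the exponent of q, and the crossing-type
    tangle that is left when all alternating vertices are smoothed. *)
Definition state := (seq bool * (int * seq oslice))%type.

Definition smoothed_slice (s : seq bool) (x : oslice) : seq (int * seq oslice) :=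
  if alternating_slice s x then
    if x is (OVert d _, i) then
      [:: (1%R, smooth_left d i); ((-1)%R, smooth_right d i)]
    else [::]
  else [:: (0%R, [:: x])].

Definition slice_states (s : seq bool) (x : slice) : seq state :=
  flatten [seq (if orient_step s (k, x.2) is Some t then
                  [seq (t, e) | e <- smoothed_slice s (k, x.2)]
                else [::]) | k <- okinds x.1].

Fixpoint states (s : seq bool) (w : seq slice) : seq state :=
  if w is x :: w' then
    [seq (v.1, (u.2.1 + v.2.1, u.2.2 ++ v.2.2)%R)
    | u <- slice_states s x, v <- states u.1 w']
  else [:: (s, (0%R, [::]))].

Definition state_value (n : nat) (R : seq oslice -> ratfun) (v : state) : ratfun :=
  (q ^ v.2.1 * crossing_bracket n R v.2.2)%R.

Lemma forget_okinds k j : k \in okinds j -> forget_kind k = j.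
Proof. by case: j; rewrite !inE; do ?[case/orP]; move=> /eqP->. Qed.

Lemma big_smoothings_cons (V : nmodType) s x w t (F : int -> seq oslice -> V) :
  orient_step s x = Some t ->
  (\sum_(e <- smoothings s (x :: w)) F e.1 e.2
   = \sum_(u <- smoothed_slice s x) \sum_(e <- smoothings t w)
       F (u.1 + e.1) (u.2 ++ e.2))%R.
Proof.
rewrite /= /smoothed_slice => ->.
case: ifP => alt; last first.
  by rewrite big_map big_seq1; apply: eq_bigr => e _; rewrite /= add0r.
case: x alt => -[d||c d] i //= _.
rewrite big_cat !big_map big_cons big_seq1 /=.
by congr (_ + _)%R; apply: eq_bigr => e _; rewrite addrC.
Qed.

(** Orienting a whole word before smoothing it, or orienting and smoothing it
    slice by slice, enumerates the same data. *)
Lemma big_states (V : nmodType) s w (F : seq bool -> int -> seq oslice -> V) :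
  (\sum_(o <- labelings w)
     (if orient_run s o is Some t then
        \sum_(e <- smoothings s o) F t e.1 e.2 else 0)
   = \sum_(v <- states s w) F v.1 v.2.1 v.2.2)%R.
Proof.
elim: w s F => [|[j i] w IH] s F; first by rewrite !big_seq1 /= big_seq1.
rewrite big_allpairs_dep [RHS]big_allpairs_dep /slice_states big_flatten big_map.
apply: eq_bigr => k _ /=.
case E: (orient_step s (k, i)) => [t|] /=; last by rewrite big_nil big1.
rewrite big_map /=.
under [RHS]eq_bigr => u _ do
  rewrite -(IH t (fun t' e o => F t' (u.1 + e)%R (u.2 ++ o))).
rewrite [RHS]exchange_big /=; apply: eq_bigr => o _.
case: (orient_run t o) => [t'|]; last by rewrite big1.
have := big_smoothings_cons o (F t') E; rewrite /= E; exact.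
Qed.

Lemma evaluation_states n R w :
  (evaluation n R w = \sum_(v <- states [::] w | v.1 == [::]) state_value n R v)%R.
Proof.
rewrite /evaluation /orientations big_filter big_mkcond [RHS]big_mkcond.
pose F (t : seq bool) e o : ratfun :=
  if t == [::] then (q ^ e * crossing_bracket n R o)%R else 0%R.
rewrite -(big_states [::] w F).
apply: eq_bigr => o _; rewrite /oriented_graph /bracket /F.
case: (orient_run _ o) => [t|] //.
by rewrite (inj_eq Some_inj); case: ifP => // _; rewrite big1.
Qed.

Lemma big_states_cat (V : nmodType) s w1 w2 (F : state -> V) :
  (\sum_(v <- states s (w1 ++ w2)) F v
   = \sum_(u <- states s w1) \sum_(v <- states u.1 w2)
       F (v.1, (u.2.1 + v.2.1, u.2.2 ++ v.2.2)))%R.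
Proof.
elim: w1 s F => [|x w1 IH] s F /=.
  rewrite big_seq1 /=; apply: eq_bigr => -[t [e o]] _ /=.
  by rewrite add0r.
rewrite !big_allpairs_dep; apply: eq_bigr => u _.
rewrite (IH u.1 (fun v => F (v.1, (u.2.1 + v.2.1, u.2.2 ++ v.2.2)%R))).
by apply: eq_bigr => y _; apply: eq_bigr => v _ /=; rewrite addrA catA.
Qed.

(** The strands of an alternating vertex that are joined by a smoothing have
    compatible directions, for either smoothing. *)
Lemma smoothed_slice_tangle s x t u : orient_step s x = Some t ->
  u \in smoothed_slice s x -> tangle s u.2 t.
Proof.
case: x => k i E; rewrite /smoothed_slice; case: ifP => alt; last first.
  by rewrite inE => /eqP -> /=; rewrite tangle_cons alt E tangle_nil eqxx.
case: k E alt => // c d E alt.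
suff h v : v \in [:: [::]; [:: (OCap, i); (OCup c, i)]] -> tangle s v t.
  rewrite !inE => /orP[] /eqP-> /=; apply: h;
    by rewrite /smooth_left /smooth_right !inE; case: (c); rewrite eqxx ?orbT.
move: alt; rewrite /alternating_slice.
have := orient_step_fits E => /= fit; move: E; rewrite /orient_step.
have [a [b [r E]]] := drop_ge2 fit; rewrite E.
have sl : size (take i s) = i by rewrite size_takel //; lia.
have es : s = take i s ++ [:: a; b] ++ r by rewrite /= -E cat_take_drop.
move: es; move: (take i s) sl => l <- {E fit i} ->.
case: ifP => // bal [<-].
rewrite nth_cat ltnn subnn /= nth_cat ltnNge leqnSn /= subSnn /= => alt.
have -> : [:: (OCap, size l); (OCup c, size l)]
          = embed (size l) [:: (OCap, 0); (OCup c, 0)] by rewrite /embed /= addn0.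
suff h p : p \in [:: [::]; [:: (OCap, 0); (OCup c, 0)]] ->
    tangle [:: a; b] p [:: c; d].
  rewrite !inE => /orP[] /eqP ->.
    by apply: (@tangle_frame l r [:: a; b] [::] [:: c; d]); apply: h.
  by apply: (@tangle_frame l r [:: a; b] _ [:: c; d]); apply: h; rewrite !inE eqxx orbT.
by rewrite !inE => /orP[] /eqP ->; move: bal alt; case: a; case: b; case: c; case: d.
Qed.

Lemma states_tangle s w v : v \in states s w -> tangle s v.2.2 v.1.
Proof.
elim: w s v => [|x w IH] s v /=; first by rewrite inE => /eqP ->; rewrite tangle_nil.
case/allpairsPdep => u [y [hu /IH hy ->]] /=.
suff hs : tangle s u.2.2 u.1 by rewrite (tangle_cat _ _ hs).
move: hu => /flattenP[vs /mapP[k _ ->]].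
case E: (orient_step _ _) => [t|] // /mapP[e he ->] /=.
exact: smoothed_slice_tangle E he.
Qed.

Lemma slice_states_size s x u : u \in slice_states s x ->
  size u.1 = size s - ins x.1 + outs x.1.
Proof.
move=> /flattenP[vs /mapP[k hk ->]].
case E: (orient_step _ _) => [t|] // /mapP[e he ->] /=.
by rewrite (orient_step_size E) /= (forget_okinds hk).
Qed.

Lemma states_size s w v k :
  v \in states s w -> width_run (size s) w = Some k -> size v.1 = k.
Proof.
elim: w s v => [|x w IH] s v /=; first by rewrite inE => /eqP -> [].
case/allpairsPdep => u [y [hu hy ->]] /=; rewrite /width_step.
by case: ifP => // _ /=; rewrite -(slice_states_size hu); apply: IH.
Qed.

Definition frame_state (l r : seq bool) (v : state) : state :=
  (l ++ v.1 ++ r, (v.2.1, embed (size l) v.2.2)).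

Lemma slice_states_frame l r s x : x.2 + ins x.1 <= size s ->
  slice_states (l ++ s ++ r) (x.1, size l + x.2)
  = [seq frame_state l r u | u <- slice_states s x].
Proof.
case: x => j i /= fit; rewrite /slice_states map_flatten -map_comp.
congr flatten; apply/eq_in_map => k hk /=.
have /= ek := forget_okinds hk; rewrite -ek in fit.
rewrite (@orient_step_frame l r s (k, i)) //.
case: (orient_step s (k, i)) => [t|] //=.
rewrite -map_comp /smoothed_slice (@alternating_slice_frame l r s (k, i)) //.
case: ifP => // _; case: k {hk ek fit} => [d||c d] //=.
by rewrite /frame_state /smooth_left /smooth_right /=; case: c.
Qed.

Lemma states_frame l r s w k : width_run (size s) w = Some k ->
  states (l ++ s ++ r) (embed (size l) w)
  = [seq frame_state l r v | v <- states s w].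
Proof.
elim: w s => [|x w IH] s //=; rewrite /width_step.
case: ifP => // fit /= hw; rewrite slice_states_frame // map_allpairs allpairs_mapl.
congr flatten; apply/eq_in_map => u hu /=.
rewrite IH -?map_comp; last by rewrite (slice_states_size hu).
by apply: eq_map => v /=; rewrite /frame_state /= embed_cat.
Qed.

(** * Relations inside a disk *)

Lemma q_neq0 : q != 0%R.
Proof. by rewrite /q tofrac_eq0 polyX_eq0. Qed.

Definition tangle_sum (s t : seq bool) (w : seq slice)
    (f : seq oslice -> ratfun) : ratfun :=
  (\sum_(v <- states s w | v.1 == t) q ^ v.2.1 * f v.2.2)%R.

(** The evaluation is bilinear in the inside and the outside of a disk, summed
    over the directions t of the strands leaving the disk upwards. *)
Lemma evaluation_disk n R a w b i k k' m :
  width_run k w = Some k' -> width_run 0 a = Some m -> i + k <= m ->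
  (evaluation n R (a ++ embed i w ++ b) =
   \sum_(u <- states [::] a) \sum_(t : k'.-tuple bool)
   \sum_(v <- states (take i u.1 ++ t ++ drop (i + k) u.1) b | v.1 == [::])
     q ^ (u.2.1 + v.2.1)
     * tangle_sum (take k (drop i u.1)) t w
         (fun p => crossing_bracket n R (u.2.2 ++ embed i p ++ v.2.2)))%R.
Proof.
move=> hw ha fit; rewrite evaluation_states big_mkcond big_states_cat.
apply: eq_big_seq => -[s [e o]] hs /=.
have sz : size s = m by apply: (states_size hs ha).
set l := take i s; set r := drop (i + k) s; set x := take k (drop i s).
have sl : size l = i by rewrite size_takel // sz; lia.
have sx : size x = k by rewrite size_takel // size_drop sz; lia.
have es : s = l ++ x ++ r.
  by rewrite /r addnC -drop_drop /x cat_take_drop /l cat_take_drop.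
have hx : width_run (size x) w = Some k' by rewrite sx.
rewrite big_states_cat {1}es -{1}sl (states_frame l r hx) big_map.
under [RHS]eq_bigr => t _ do under eq_bigr => v _ do rewrite /tangle_sum big_distrr /=.
under [RHS]eq_bigr => t _ do rewrite exchange_big big_mkcond /=.
rewrite exchange_big /=; apply: eq_big_seq => -[y [ey p]] hy /=.
have sy : size y == k' by rewrite (states_size hy hx).

(* Each state of the inside contributes to the single t that it ends with. *)
rewrite (bigD1 (Tuple sy)) //= eqxx [X in _ = (_ + X)%R]big1 ?addr0; last first.
  move=> t nt; case: eqP => // yt; by move: nt; rewrite -val_eqE /= -yt eqxx.
rewrite [RHS]big_mkcond; apply: eq_bigr => -[z [ez o']] _ /=.
case: ifP => // _.
rewrite /state_value /= sl; have -> : (e + (ey + ez) = (e + ez) + ey)%R by ring.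
by rewrite expfzDr ?q_neq0 // -mulrA.
Qed.

Lemma local_relation n R k k' w w1 w2 c1 c2 :
  width_run k w = Some k' -> width_run k w1 = Some k' ->
  width_run k w2 = Some k' ->
  (forall s t l r o1 o2, size s = k -> size t = k' ->
     tangle [::] o1 (l ++ s ++ r) -> tangle (l ++ t ++ r) o2 [::] ->
     let f p := crossing_bracket n R (o1 ++ embed (size l) p ++ o2) in
     tangle_sum s t w f = c1 * tangle_sum s t w1 f + c2 * tangle_sum s t w2 f)%R ->
  forall a b i m, width_run 0 a = Some m -> i + k <= m ->
  (evaluation n R (a ++ embed i w ++ b)
   = c1 * evaluation n R (a ++ embed i w1 ++ b)
     + c2 * evaluation n R (a ++ embed i w2 ++ b))%R.
Proof.
move=> hw hw1 hw2 rel a b i m ha fit.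
rewrite (evaluation_disk _ _ _ hw ha fit) (evaluation_disk _ _ _ hw1 ha fit).
rewrite (evaluation_disk _ _ _ hw2 ha fit).
rewrite !big_distrr -big_split; apply: eq_big_seq => -[s [e o]] hs /=.
rewrite !big_distrr -big_split; apply: eq_bigr => t _ /=.
rewrite !big_distrr -big_split big_seq_cond [RHS]big_seq_cond.
apply: eq_bigr => -[z [ez o']] /= /andP[hz /eqP z0].
have sz : size s = m by apply: (states_size hs ha).
have sl : size (take i s) = i by rewrite size_takel // sz; lia.
have sx : size (take k (drop i s)) = k by rewrite size_takel // size_drop sz; lia.
have := rel (take k (drop i s)) t (take i s) (drop (i + k) s) o o' sx.
rewrite size_tuple sl => -> //.
- by ring.
- rewrite addnC -drop_drop !cat_take_drop; exact: (states_tangle hs).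
- by have := states_tangle hz; rewrite /= z0.
Qed.

(** * Interchangeable crossing-type tangles *)

(** The turnings are compared along with the values of R, so that equivalent
    tangles may also be exchanged in [crossing_bracket]. *)
Definition tangle_equiv (R : seq oslice -> ratfun) (s t : seq bool)
    (p p' : seq oslice) : Prop :=
  [/\ tangle s p t, tangle s p' t, turning s p = turning s p'
    & forall l r o1 o2,
        tangle [::] o1 (l ++ s ++ r) -> tangle (l ++ t ++ r) o2 [::] ->
        R (o1 ++ embed (size l) p ++ o2) = R (o1 ++ embed (size l) p' ++ o2)].

Lemma tangle_close o1 s p t o2 :
  tangle [::] o1 s -> tangle s p t -> tangle t o2 [::] ->
  tangle [::] (o1 ++ p ++ o2) [::].
Proof. by move=> h1 h2 h3; rewrite (tangle_cat _ _ h1) (tangle_cat _ _ h2). Qed.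

Lemma tangle_equiv_refl R s p t : tangle s p t -> tangle_equiv R s t p p.
Proof. by []. Qed.

Lemma tangle_equiv_sym R s t p p' :
  tangle_equiv R s t p p' -> tangle_equiv R s t p' p.
Proof. by case=> h1 h2 h3 h4; split=> // l r o1 o2 k1 k2; rewrite (h4 l r). Qed.

Lemma tangle_equiv_trans R s t p1 p2 p3 :
  tangle_equiv R s t p1 p2 -> tangle_equiv R s t p2 p3 ->
  tangle_equiv R s t p1 p3.
Proof.
case=> h1 h2 h3 h4 [g1 g2 g3 g4]; split=> //; first by rewrite h3.
by move=> l r o1 o2 k1 k2; rewrite (h4 l r) // (g4 l r).
Qed.

Lemma tangle_equiv_frame R l r s t p p' : tangle_equiv R s t p p' ->
  tangle_equiv R (l ++ s ++ r) (l ++ t ++ r) (embed (size l) p) (embed (size l) p').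
Proof.
case=> h1 h2 h3 h4; split; try exact: tangle_frame.
  by rewrite (turning_frame _ _ h1) (turning_frame _ _ h2).
move=> l' r' o1 o2; rewrite !embed_embed -size_cat.
have E u : l' ++ (l ++ u ++ r) ++ r' = (l' ++ l) ++ u ++ (r ++ r').
  by rewrite !catA.
by rewrite !E; apply: h4.
Qed.

Lemma tangle_equiv_cat R s p1 p1' t p2 p2' u :
  tangle_equiv R s t p1 p1' -> tangle_equiv R t u p2 p2' ->
  tangle_equiv R s u (p1 ++ p2) (p1' ++ p2').
Proof.
case=> h1 h2 h3 h4 [g1 g2 g3 g4]; split.
- by rewrite (tangle_cat _ _ h1).
- by rewrite (tangle_cat _ _ h2).
- by rewrite (turning_cat _ h1) (turning_cat _ h2) h3 g3.
move=> l r o1 o2 k1 k2; rewrite !embed_cat -!catA (h4 l r) //; last first.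
  by rewrite (tangle_cat _ _ (tangle_frame l r g1)).
have := g4 l r (o1 ++ embed (size l) p1') o2; rewrite -!catA; apply=> //.
by rewrite (tangle_cat _ _ k1) tangle_frame.
Qed.

Lemma tangle_equiv_catl R s c t p p' u :
  tangle s c t -> tangle_equiv R t u p p' -> tangle_equiv R s u (c ++ p) (c ++ p').
Proof. by move=> h; apply: tangle_equiv_cat; apply: tangle_equiv_refl. Qed.

Lemma isotopy_move_embed i m m' :
  isotopy_move m m' -> isotopy_move (embed i m) (embed i m').
Proof.
case=> [k l j h|j|j|j|j] /=; rewrite ?addnS ?addnA.
- exact: move_exchange.
- exact: move_zigzagl.
- exact: move_zigzagr.
- exact: move_rotatel.
- exact: move_rotater.
Qed.

Lemma forget_embed i w : forget (embed i w) = embed i (forget w).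
Proof. by rewrite /forget /embed -!map_comp. Qed.

Lemma tangle_equiv_move n R s t p p' : MOY_polynomial n R ->
  isotopy_move (forget p) (forget p') -> tangle s p t -> tangle s p' t ->
  turning s p = turning s p' -> tangle_equiv R s t p p'.
Proof.
move=> hR mv h h' turn; split=> // l r o1 o2 k1 k2; apply: (moy_isotopy hR).
have [f f'] := (tangle_frame l r h, tangle_frame l r h').
exists o1, (embed (size l) p), (embed (size l) p'), o2; split=> //.
- by rewrite !forget_embed; apply: isotopy_move_embed.
- by rewrite !orient_run_cat (tangle_orient k1) /= !(tangle_orient (t := l ++ t ++ r)).
- by split; [apply: tangle_close k1 f k2 | apply: tangle_close k1 f' k2].
Qed.

Lemma tangle_frame_right r s w t :
  tangle s w t -> tangle (s ++ r) w (t ++ r).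
Proof. by move/(tangle_frame [::] r); rewrite embed0. Qed.

Lemma tangle_frame_left l s w t :
  tangle s w t -> tangle (l ++ s) (embed (size l) w) (l ++ t).
Proof. by move/(tangle_frame l [::]); rewrite !cats0. Qed.

Lemma turning_frame_right r s w t :
  tangle s w t -> turning (s ++ r) w = turning s w.
Proof. by move/(turning_frame [::] r); rewrite embed0. Qed.

Lemma turning_frame_left l s w t :
  tangle s w t -> turning (l ++ s) (embed (size l) w) = turning s w.
Proof. by move/(turning_frame l [::]); rewrite cats0. Qed.

Lemma exchange_below x p x' y z p' z' : tangle x p x' -> tangle z p' z' ->
  let w := p ++ embed (size x' + size y) p' in
  tangle (x ++ y ++ z) w (x' ++ y ++ z')
  /\ turning (x ++ y ++ z) w = (turning x p + turning z p')%R.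
Proof.
move=> h h' /=; have g := tangle_frame_right (y ++ z) h.
rewrite (tangle_cat _ _ g) (turning_cat _ g) (turning_frame_right _ h).
by rewrite -size_cat !catA (turning_frame_left _ h') tangle_frame_left.
Qed.

Lemma exchange_above x p x' y z p' z' : tangle x p x' -> tangle z p' z' ->
  let w := embed (size x + size y) p' ++ p in
  tangle (x ++ y ++ z) w (x' ++ y ++ z')
  /\ turning (x ++ y ++ z) w = (turning x p + turning z p')%R.
Proof.
move=> h h' /=; have := tangle_frame_left (x ++ y) h'.
rewrite -size_cat !catA => g; rewrite (tangle_cat _ _ g) (turning_cat _ g).
rewrite (turning_frame_left _ h') addrC -!catA (turning_frame_right _ h).
by rewrite tangle_frame_right.
Qed.

Lemma exchange_slices n R x c x' y z d z' : MOY_polynomial n R ->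
  tangle x [:: c] x' -> tangle z [:: d] z' ->
  tangle_equiv R (x ++ y ++ z) (x' ++ y ++ z')
    ([:: c] ++ embed (size x' + size y) [:: d])
    (embed (size x + size y) [:: d] ++ [:: c]).
Proof.
move=> hR h h'; have [g1 t1] := exchange_below y h h'.
have [g2 t2] := exchange_above y h h'.
apply: (tangle_equiv_move hR) => //; last by rewrite t1 t2.
case: c h {g1 t1 g2 t2} => k i h; case: d {h'} => k' j.
have [l [u [v [r [[-> -> <-] [_ su sv]]]]]] := tangle_slice h.
rewrite /= !size_cat su sv.
have := move_exchange (forget_kind k) (forget_kind k') (size l) (size r + size y + j).
by rewrite /= !addnA.
Qed.

Lemma exchange_slice n R x c x' y z p z' : MOY_polynomial n R ->
  tangle x [:: c] x' -> tangle z p z' ->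
  tangle_equiv R (x ++ y ++ z) (x' ++ y ++ z')
    ([:: c] ++ embed (size x' + size y) p)
    (embed (size x + size y) p ++ [:: c]).
Proof.
move=> hR h; elim: p z => [|d p IH] z.
  rewrite tangle_nil => /eqP <- /=; apply: tangle_equiv_refl.
  exact: tangle_frame_right.
rewrite -cat1s => /tangle_catP[u h1 h2].
have h3 := tangle_equiv_refl R (tangle_frame_left (x' ++ y) h2).
have h4 := tangle_equiv_refl R (tangle_frame_left (x ++ y) h1).
rewrite size_cat -!catA in h3; rewrite size_cat -!catA in h4.
have := tangle_equiv_cat (exchange_slices y hR h h1) h3.
rewrite -!catA -embed_cat => /tangle_equiv_trans; apply.
have := tangle_equiv_cat h4 (IH _ h2).
by rewrite [embed _ [:: d] ++ embed _ p ++ _]catA -embed_cat.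
Qed.

(** The isotopy moves exchange single slices, whereas a smoothed vertex
    consists of zero, one or two slices: two tangles side by side are moved
    past each other slice by slice. *)
Lemma exchange_tangles n R x p x' y z p' z' : MOY_polynomial n R ->
  tangle x p x' -> tangle z p' z' ->
  tangle_equiv R (x ++ y ++ z) (x' ++ y ++ z')
    (p ++ embed (size x' + size y) p') (embed (size x + size y) p' ++ p).
Proof.
move=> hR + h'; elim: p x => [|c p IH] x.
  rewrite tangle_nil => /eqP <- /=; rewrite cats0; apply: tangle_equiv_refl.
  by have := tangle_frame_left (x ++ y) h'; rewrite size_cat -!catA.
rewrite -cat1s => /tangle_catP[u h1 h2].
have h3 := tangle_equiv_refl R (tangle_frame_right (y ++ z) h1).
have h4 := tangle_equiv_refl R (tangle_frame_right (y ++ z') h2).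
have := tangle_equiv_cat h3 (IH _ h2).
rewrite [[:: c] ++ p ++ _]catA => /tangle_equiv_trans; apply.
have := tangle_equiv_cat (exchange_slice y hR h1 h') h4.
by rewrite -!catA.
Qed.

(** Rotation numbers are compared without knowing how the circles close up
    outside of the disk. *)
Lemma rotnum_disk s p p' t o1 o2 l r z : tangle s p t -> tangle s p' t ->
  tangle [::] o1 (l ++ s ++ r) -> tangle (l ++ t ++ r) o2 [::] ->
  (turning s p = turning s p' + z *+ 2)%R ->
  (rotnum (o1 ++ embed (size l) p ++ o2)
   = rotnum (o1 ++ embed (size l) p' ++ o2) + z)%R.
Proof.
move=> h h' k1 k2 turn.
have [g g'] := (tangle_frame l r h, tangle_frame l r h').
have := rotnum_turning (tangle_close k1 g k2).
have := rotnum_turning (tangle_close k1 g' k2).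
rewrite !(turning_cat _ k1) (turning_cat _ g) (turning_cat _ g').
rewrite (turning_frame _ _ h) (turning_frame _ _ h') turn.
by move: (rotnum _) (rotnum _) (turning _ _) (turning _ _) (turning _ _); lia.
Qed.

Lemma tangle_equiv_bracket n R s t p p' l r o1 o2 : tangle_equiv R s t p p' ->
  tangle [::] o1 (l ++ s ++ r) -> tangle (l ++ t ++ r) o2 [::] ->
  crossing_bracket n R (o1 ++ embed (size l) p ++ o2)
  = crossing_bracket n R (o1 ++ embed (size l) p' ++ o2).
Proof.
case=> h h' turn eR k1 k2; rewrite /crossing_bracket (eR l r) //.
by rewrite (rotnum_disk (z := 0) h h' k1 k2) ?addr0 // turn mul0rn addr0.
Qed.

(** * Isotopy invariance of the evaluation *)

(** The states are listed in the same order on the two sides of a zigzag or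
    rotation move, so they are paired in that order. *)
Fixpoint states_match (P : seq bool -> seq oslice -> seq oslice -> Prop)
    (vs vs' : seq state) : Prop :=
  match vs, vs' with
  | [::], [::] => True
  | v :: vs, v' :: vs' =>
      (v.1 = v'.1 /\ v.2.1 = v'.2.1)
      /\ (P v.1 v.2.2 v'.2.2 /\ states_match P vs vs')
  | _, _ => False
  end.

Lemma tangle_sum_match n R s t w w' l r o1 o2 :
  states_match (tangle_equiv R s) (states s w) (states s w') ->
  tangle [::] o1 (l ++ s ++ r) -> tangle (l ++ t ++ r) o2 [::] ->
  let f p := crossing_bracket n R (o1 ++ embed (size l) p ++ o2) in
  tangle_sum s t w f = tangle_sum s t w' f.
Proof.
move=> + k1 k2 f; rewrite /tangle_sum.
elim: (states s w) (states s w') => [|[x [e p]] vs IH] [|[x' [e' p']] vs'] //=.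
case=> -[<- <-] [eqv /IH E]; rewrite !big_cons E /=.
by case: eqP => // xt; rewrite xt in eqv; rewrite /f (tangle_equiv_bracket n eqv k1 k2).
Qed.

Section LocalIsotopies.
Variables (n : nat) (R : seq oslice -> ratfun).
Hypothesis hR : MOY_polynomial n R.

Lemma zigzagl_equiv d :
  tangle_equiv R [:: d] [:: d] [:: (OCup d, 0); (OCap, 1)] [::].
Proof. by apply: (tangle_equiv_move hR); [exact: (move_zigzagl 0)|..]; case: d. Qed.

Lemma zigzagr_equiv d :
  tangle_equiv R [:: d] [:: d] [:: (OCup (~~ d), 1); (OCap, 0)] [::].
Proof. by apply: (tangle_equiv_move hR); [exact: (move_zigzagr 0)|..]; case: d. Qed.

Lemma rotatel_equiv a b c d : tangle [:: a; b] [:: (OVert c d, 0)] [:: c; d] ->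
  tangle_equiv R [:: a; b] [:: c; d]
    [:: (OCup (~~ d), 2); (OVert (~~ a) c, 1); (OCap, 0)] [:: (OVert c d, 0)].
Proof.
move=> h; apply: (tangle_equiv_move hR); [exact: (move_rotatel 0)|..]; move: h;
by case: a; case: b; case: c; case: d.
Qed.

Lemma rotater_equiv a b c d : tangle [:: a; b] [:: (OVert c d, 0)] [:: c; d] ->
  tangle_equiv R [:: a; b] [:: c; d]
    [:: (OCup c, 0); (OVert d (~~ b), 1); (OCap, 2)] [:: (OVert c d, 0)].
Proof.
move=> h; apply: (tangle_equiv_move hR); [exact: (move_rotater 0)|..]; move: h;
by case: a; case: b; case: c; case: d.
Qed.

(** The smoothing of a rotated alternating vertex into vertical arcs is a
    minimum and a maximum side by side, which a change of heights turns into
    the horizontal smoothing of the vertex. *)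
Lemma cup_right_cap_equiv a d : tangle_equiv R [:: a; ~~ a] [:: d; ~~ d]
  [:: (OCup d, 2); (OCap, 0)] [:: (OCap, 0); (OCup d, 0)].
Proof.
apply: tangle_equiv_sym; apply: (tangle_equiv_move hR);
  by [exact: (move_exchange Cap Cup 0 0) | case: a; case: d].
Qed.

Lemma cup_left_cap_equiv a d : tangle_equiv R [:: a; ~~ a] [:: d; ~~ d]
  [:: (OCup d, 0); (OCap, 2)] [:: (OCap, 0); (OCup d, 0)].
Proof.
apply: (tangle_equiv_move hR);
  by [exact: (move_exchange Cup Cap 0 0) | case: a; case: d].
Qed.

(** The smoothing of a rotated alternating vertex into horizontal arcs
    straightens out to the vertical smoothing of the vertex. *)
Lemma double_zigzagr_equiv d : tangle_equiv R [:: d; ~~ d] [:: d; ~~ d]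
  [:: (OCup d, 2); (OCap, 1); (OCup (~~ d), 1); (OCap, 0)] [::].
Proof.
have h1 := tangle_equiv_frame [:: d] [::] (zigzagr_equiv (~~ d)).
have h2 := tangle_equiv_frame [::] [:: ~~ d] (zigzagr_equiv d).
by have := tangle_equiv_cat h1 h2; rewrite /= negbK.
Qed.

Lemma double_zigzagl_equiv d : tangle_equiv R [:: d; ~~ d] [:: d; ~~ d]
  [:: (OCup d, 0); (OCap, 1); (OCup (~~ d), 1); (OCap, 2)] [::].
Proof.
have h1 := tangle_equiv_frame [::] [:: ~~ d] (zigzagl_equiv d).
have h2 := tangle_equiv_frame [:: d] [::] (zigzagl_equiv (~~ d)).
by have := tangle_equiv_cat h1 h2.
Qed.

Lemma zigzagl_match s : size s = 1 ->
  states_match (tangle_equiv R s) (states s [:: (Cup, 0); (Cap, 1)]) (states s [::]).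
Proof.
case: s => [|d [|]] // _.
by case: d; lazy -[tangle_equiv]; repeat apply: conj => //; apply: zigzagl_equiv.
Qed.

Lemma zigzagr_match s : size s = 1 ->
  states_match (tangle_equiv R s) (states s [:: (Cup, 1); (Cap, 0)]) (states s [::]).
Proof.
case: s => [|d [|]] // _.
by case: d; lazy -[tangle_equiv]; repeat apply: conj => //; apply: zigzagr_equiv.
Qed.

Lemma rotatel_match s : size s = 2 ->
  states_match (tangle_equiv R s)
    (states s [:: (Cup, 2); (Vert, 1); (Cap, 0)]) (states s [:: (Vert, 0)]).
Proof.
case: s => [|a [|b [|]]] // _.
by case: a; case: b; lazy -[tangle_equiv]; repeat apply: conj => //;
  by [apply: rotatel_equiv | apply: cup_right_cap_equiv |
      apply: double_zigzagr_equiv].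
Qed.

Lemma rotater_match s : size s = 2 ->
  states_match (tangle_equiv R s)
    (states s [:: (Cup, 0); (Vert, 1); (Cap, 2)]) (states s [:: (Vert, 0)]).
Proof.
case: s => [|a [|b [|]]] // _.
by case: a; case: b; lazy -[tangle_equiv]; repeat apply: conj => //;
  by [apply: rotater_equiv | apply: cup_left_cap_equiv |
      apply: double_zigzagl_equiv].
Qed.

End LocalIsotopies.

Lemma width_run_cat m w1 w2 :
  width_run m (w1 ++ w2) = obind (width_run^~ w2) (width_run m w1).
Proof. by elim: w1 m => [|x w1 IH] m //=; case: (width_step m x). Qed.

#[local] Arguments states : simpl never.

(** Slices side by side are oriented and smoothed independently, so that the
    sums over their states commute. *)
Lemma tangle_sum_exchange n R k l x y z t lx rx o1 o2 : MOY_polynomial n R ->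
  size x = ins k -> size z = ins l ->
  tangle [::] o1 (lx ++ (x ++ y ++ z) ++ rx) -> tangle (lx ++ t ++ rx) o2 [::] ->
  let f p := crossing_bracket n R (o1 ++ embed (size lx) p ++ o2) in
  tangle_sum (x ++ y ++ z) t [:: (k, 0); (l, outs k + size y)] f
  = tangle_sum (x ++ y ++ z) t [:: (l, ins k + size y); (k, 0)] f.
Proof.
move=> hR sx sz k1 k2 f; rewrite /tangle_sum big_mkcond [RHS]big_mkcond.
have wk (u : seq bool) : size u = ins k -> width_run (size u) [:: (k, 0)] = Some (outs k).
  by move=> su; rewrite /= /width_step /= su leqnn subnn.
have wl (u : seq bool) : size u = ins l -> width_run (size u) [:: (l, 0)] = Some (outs l).
  by move=> su; rewrite /= /width_step /= su leqnn subnn.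
have stk v : states (x ++ v) [:: (k, 0)]
    = [seq frame_state [::] v u | u <- states x [:: (k, 0)]].
  by rewrite -(states_frame [::] v (wk x sx)).
have stl (v : seq bool) m : size v = m -> states (v ++ z) [:: (l, m)]
    = [seq frame_state v [::] u | u <- states z [:: (l, 0)]].
  by move=> <-; rewrite -(states_frame v [::] (wl z sz)) cats0 /embed /= addn0.
rewrite -[[:: (k, 0); _]]cat1s -[[:: (l, _); _]]cat1s !big_states_cat.
rewrite stk big_map [in RHS]catA (stl (x ++ y)) ?size_cat ?sx // [RHS]big_map.
transitivity (\sum_(u <- states x [:: (k, 0)]) \sum_(v <- states z [:: (l, 0)])
   (if u.1 ++ y ++ v.1 == t
    then q ^ (u.2.1 + v.2.1)
         * f (u.2.2 ++ embed (size u.1 + size y) v.2.2) else 0))%R.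
  apply: eq_big_seq => -[x' [e p]] hu /=.
  have sx' : size x' = outs k by apply: (states_size hu (wk _ sx)).
  rewrite catA (stl (x' ++ y)) ?size_cat ?sx' // big_map.
  by apply: eq_bigr => -[z' [e' p']] _ /=; rewrite embed0 cats0 -catA size_cat sx'.
rewrite exchange_big; apply: eq_big_seq => -[z' [e' p']] hv /=.
rewrite cats0 -catA stk big_map; apply: eq_big_seq => -[x' [e p]] hu /=.
case: eqP => // et; rewrite embed0 [(e' + e)%R]addrC; congr (_ * _)%R.
have [/= h h'] := (states_tangle hu, states_tangle hv).
rewrite -et in k2; rewrite size_cat.
exact: (tangle_equiv_bracket n (exchange_tangles y hR h h') k1 k2).
Qed.

Lemma evaluation_local n R k k' w w' :
  width_run k w = Some k' -> width_run k w' = Some k' ->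
  (forall s t l r o1 o2, size s = k -> size t = k' ->
     tangle [::] o1 (l ++ s ++ r) -> tangle (l ++ t ++ r) o2 [::] ->
     let f p := crossing_bracket n R (o1 ++ embed (size l) p ++ o2) in
     tangle_sum s t w f = tangle_sum s t w' f) ->
  forall a b i m, width_run 0 a = Some m -> i + k <= m ->
  evaluation n R (a ++ embed i w ++ b) = evaluation n R (a ++ embed i w' ++ b).
Proof.
move=> hw hw' rel a b i m ha fit.
have rel' := @local_relation n R k k' w w' w' 1%R 0%R hw hw' hw'.
have := rel' _ a b i m ha fit; rewrite mul1r mul0r addr0; apply.
move=> s t l r o1 o2 ss st k1 k2 /=.
by rewrite mul1r mul0r addr0; apply: rel k1 k2.
Qed.

Lemma evaluation_match n R k k' w w' : width_run k w = Some k' ->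
  width_run k w' = Some k' ->
  (forall s, size s = k ->
     states_match (tangle_equiv R s) (states s w) (states s w')) ->
  forall a b i m, width_run 0 a = Some m -> i + k <= m ->
  evaluation n R (a ++ embed i w ++ b) = evaluation n R (a ++ embed i w' ++ b).
Proof.
move=> hw hw' rel; apply: evaluation_local hw hw' _ => s t l r o1 o2 ss _ k1 k2.
exact: (tangle_sum_match n (rel s ss) k1 k2).
Qed.

Lemma width_run_local a w b : planar_graph (a ++ w ++ b) ->
  exists m, width_run 0 a = Some m /\ width_run m w <> None.
Proof.
rewrite /planar_graph width_run_cat; case: (width_run 0 a) => [m|] //=.
by rewrite width_run_cat => h; exists m; split=> // E; rewrite E in h.
Qed.

Lemma evaluation_isotopy_step n R w1 w2 : MOY_polynomial n R ->
  isotopy_step w1 w2 -> evaluation n R w1 = evaluation n R w2.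
Proof.
move=> hR [a [m1 [m2 [b [-> -> mv h1 h2]]]]].
have [m [ha]] := width_run_local h1; have [m' [ha']] := width_run_local h2.
move: ha'; rewrite ha => -[<-] {m' h1 h2}.
have step k k' w w' i : width_run k w = Some k' -> width_run k w' = Some k' ->
    (forall s, size s = k ->
      states_match (tangle_equiv R s) (states s w) (states s w')) -> i + k <= m ->
    evaluation n R (a ++ embed i w ++ b) = evaluation n R (a ++ embed i w' ++ b).
  by move=> hw hw' rel; apply: (evaluation_match n hw hw' rel b ha).
case: mv => {m1 m2} [k l i j|i|i|i|i] /=; rewrite /width_step /=.
- move=> _.
  case: ifP => // f1 /=; case: ifP => // f2 /= _.
  have hw : width_run (ins k + j + ins l) [:: (k, 0); (l, outs k + j)]
      = Some (outs k + j + outs l).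
    rewrite /= /width_step /= ifT; last by lia.
    by rewrite /= ifT; [congr Some; lia | lia].
  have hw' : width_run (ins k + j + ins l) [:: (l, ins k + j); (k, 0)]
      = Some (outs k + j + outs l).
    rewrite /= /width_step /= ifT; last by lia.
    by rewrite /= ifT; [congr Some; lia | lia].
  have fit : i + (ins k + j + ins l) <= m by lia.
  have -> : (k, i) :: (l, i + outs k + j) :: b
      = embed i [:: (k, 0); (l, outs k + j)] ++ b by rewrite /= addn0 addnA.
  have -> : (l, i + ins k + j) :: (k, i) :: b
      = embed i [:: (l, ins k + j); (k, 0)] ++ b by rewrite /= addn0 addnA.
  apply: (evaluation_local hw hw' _ b ha fit).
  move=> s t lx rx o1 o2 ss _ k1 k2 /=.

  (* The strands between the two slices are those of y. *)
  pose x := take (ins k) s; pose y := take j (drop (ins k) s).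
  pose z := drop j (drop (ins k) s).
  have es : s = x ++ y ++ z by rewrite !cat_take_drop.
  have sx : size x = ins k by rewrite size_takel // ss; lia.
  have sy : size y = j by rewrite size_takel // size_drop ss; lia.
  have sz : size z = ins l by rewrite !size_drop ss; lia.
  rewrite es -sy; rewrite es in k1.
  exact: (tangle_sum_exchange hR sx sz k1 k2).
- case: ifP => // f1 /=; case: ifP => // f2 /= _ _.
  have := step 1 1 [:: (Cup, 0); (Cap, 1)] [::] i erefl erefl (zigzagl_match hR).
  by rewrite /= addn0 addn1; apply; lia.
- case: ifP => // f1 /=; case: ifP => // f2 /= _ _.
  have := step 1 1 [:: (Cup, 1); (Cap, 0)] [::] i erefl erefl (zigzagr_match hR).
  by rewrite /= addn0 addn1; apply; lia.
- move=> _; case: ifP => // f1 _.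
  have := step 2 2 [:: (Cup, 2); (Vert, 1); (Cap, 0)] [:: (Vert, 0)] i
    erefl erefl (rotatel_match hR).
  by rewrite /= addn0 addn1 addn2; apply; lia.
- move=> _; case: ifP => // f1 /=; case: ifP => // f2 /=; case: ifP => // f3 _.
  have := step 2 2 [:: (Cup, 0); (Vert, 1); (Cap, 2)] [:: (Vert, 0)] i
    erefl erefl (rotater_match hR).
  by rewrite /= addn0 addn1 addn2; apply; lia.
Qed.

Lemma evaluation_isotopic n R w1 w2 : MOY_polynomial n R ->
  isotopic w1 w2 -> evaluation n R w1 = evaluation n R w2.
Proof.
move=> hR; elim=> {w1 w2} [w1 w2|//|w1 w2 _ -> //|w1 w2 w3 _ -> _ -> //].
exact: evaluation_isotopy_step.
Qed.

(** * Quantum integers *)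

(** This makes the denominator q - q^-1 of the quantum integers invertible. *)
Lemma q_sqr_neq1 : (q * q - 1 != 0)%R.
Proof.
rewrite subr_eq0 /q -rmorphM -[X in _ != X]tofrac1 tofrac_eq.
apply/eqP => /(congr1 (fun p : {poly int} => size p)).
by rewrite -expr2 size_polyXn size_poly1.
Qed.

(** The identities between quantum integers hold in any field, with x in place
    of q and y in place of q ^ n; thus y / x ^+ k stands for q ^ (n - k) and
    x / y for the weight q ^ (1 - n) of a counterclockwise circle. *)
Section Coefficients.
Variables (F : fieldType) (x y : F).
Hypotheses (x0 : (x != 0)%R) (y0 : (y != 0)%R) (x1 : (x * x - 1 != 0)%R).

Definition qint_of (k : nat) (z : F) : F :=
  ((z / x ^+ k - x ^+ k / z) / (x - x^-1))%R.

Lemma two_identity : ((x ^+ 2 - (x ^+ 2)^-1) / (x - x^-1) = x + x^-1)%R.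
Proof. by field; rewrite x0 x1. Qed.

Lemma loop_identity :
  (x^-1 * (qint_of 1 y * (x / y)^-1) + x * (qint_of 1 y * (x / y))
   = qint_of 3 (y ^+ 2) + 1)%R.
Proof. by rewrite /qint_of; field; rewrite ?x0 ?y0 ?x1 ?oner_neq0. Qed.

Lemma circle_identity_cw :
  ((x ^+ 2)^-1 * (qint_of 0 y * (x / y)^-1) + 2%:R + qint_of 2 y * (x / y)
   = qint_of 3 (y ^+ 2) + 1 + (x + x^-1) * x^-1)%R.
Proof. by rewrite /qint_of; field; rewrite ?x0 ?y0 ?x1 ?oner_neq0. Qed.

Lemma circle_identity_ccw :
  (x ^+ 2 * (qint_of 0 y * (x / y)) + 2%:R + qint_of 2 y * (x / y)^-1
   = qint_of 3 (y ^+ 2) + 1 + (x + x^-1) * x)%R.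
Proof. by rewrite /qint_of; field; rewrite ?x0 ?y0 ?x1 ?oner_neq0. Qed.

End Coefficients.

Lemma qint_two : qint 2 = (q + q^-1)%R.
Proof. exact: (two_identity q_neq0 q_sqr_neq1). Qed.

Lemma qint_shift (n k : nat) : qint (n%:Z - k%:Z) = qint_of q k (q ^ n%:Z)%R.
Proof.
rewrite /qint /qint_of opprB !expfzDr ?q_neq0 //.
by congr ((_ * _ - _ * _) / _)%R; rewrite ?exprnP ?invr_expz.
Qed.

Lemma rotation_weight (n : nat) : (q ^ (1 - n%:Z) = q / q ^ n%:Z)%R.
Proof. by rewrite expfzDr ?q_neq0 // expr1z invr_expz. Qed.

Lemma qint_double (n : nat) :
  qint ((2 * n)%:Z - 3) = qint_of q 3 ((q ^ n%:Z) ^+ 2)%R.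
Proof. by rewrite (qint_shift (2 * n) 3) -!exprnP mulnC exprM. Qed.

Lemma expz_twist (F : fieldType) (x : F) d :
  (x ^ twist d = if d then x^-1 else x)%R.
Proof. by case: d. Qed.

Lemma qint_two_twist d : qint 2 = (q ^ twist d + (q ^ twist d)^-1)%R.
Proof. by rewrite qint_two expz_twist; case: d; rewrite ?invrK // addrC. Qed.

(** The two loops of [bigon_crossing] have opposite rotations and opposite
    exponents.  One gives q ^ (n - 2) [n - 1], the sum of the even powers of q
    from 1 to q ^ (2n - 4), the other the same with q^-1 for q.  Together they
    make up [2n - 3], with the power 1 occurring twice. *)
Lemma loop_coefficient (n : nat) d : let W := (q ^ (1 - n%:Z))%R in
  (q ^ twist d * (qint (n%:Z - 1) * W ^ twist d)
   + (q ^ twist d)^-1 * (qint (n%:Z - 1) * (W ^ twist d)^-1)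
   = qint ((2 * n)%:Z - 3) + 1)%R.
Proof.
rewrite /= rotation_weight qint_double (qint_shift n 1) !expz_twist.
rewrite -(loop_identity q_neq0 _ q_sqr_neq1) ?expfz_neq0 ?q_neq0 //.
by case: d; rewrite ?[((q / _)^-1)^-1%R]invrK ?[(q^-1)^-1%R]invrK // addrC.
Qed.

(** The diagram of two horizontal arcs in [bigon_smoothing] arises with a
    circle, twice without one, and from the antiparallel bigon. *)
Lemma circle_coefficient (n : nat) d : let W := (q ^ (1 - n%:Z))%R in
  ((q ^ twist d) ^+ 2 * (qint n%:Z * W ^ twist d) + 2%:R
   + qint (n%:Z - 2) * (W ^ twist d)^-1
   = qint ((2 * n)%:Z - 3) + 1 + qint 2 * q ^ twist d)%R.
Proof.
rewrite /= rotation_weight qint_double (qint_shift n 2) qint_two !expz_twist.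
have -> : qint n%:Z = qint (n%:Z - 0%:Z) by rewrite subr0.
rewrite (qint_shift n 0); case: d; rewrite ?exprVn ?invrK.
  by apply: circle_identity_cw q_sqr_neq1; rewrite ?expfz_neq0 ?q_neq0.
by apply: circle_identity_ccw q_sqr_neq1; rewrite ?expfz_neq0 ?q_neq0.
Qed.

(** * Circles, loops and bigons in a disk *)

Definition tangle_scale (R : seq oslice -> ratfun) (s t : seq bool)
    (p : seq oslice) (c : ratfun) (p' : seq oslice) : Prop :=
  [/\ tangle s p t, tangle s p' t
    & forall l r o1 o2,
        tangle [::] o1 (l ++ s ++ r) -> tangle (l ++ t ++ r) o2 [::] ->
        R (o1 ++ embed (size l) p ++ o2)
        = (c * R (o1 ++ embed (size l) p' ++ o2))%R].

Lemma tangle_equiv_scale R s t p p1 c p2 :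
  tangle_equiv R s t p p1 -> tangle_scale R s t p1 c p2 ->
  tangle_scale R s t p c p2.
Proof.
case=> h h1 _ e [_ h2 e2]; split=> // l r o1 o2 k1 k2.
by rewrite (e l r) // (e2 l r).
Qed.

Lemma tangle_scale_context R x y s t u v p c p' l r :
  tangle_scale R s t p c p' ->
  tangle u x (l ++ s ++ r) -> tangle (l ++ t ++ r) y v ->
  tangle_scale R u v (x ++ embed (size l) p ++ y) c
    (x ++ embed (size l) p' ++ y).
Proof.
case=> h h' e hx hy.
have [g g'] := (tangle_frame l r h, tangle_frame l r h').
split; try by rewrite (tangle_cat _ _ hx) ?(tangle_cat _ _ g) ?(tangle_cat _ _ g').
move=> l' r' o1 o2 k1 k2.
have := e (l' ++ l) (r ++ r') (o1 ++ embed (size l') x) (embed (size l') y ++ o2).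
rewrite !embed_cat !embed_embed size_cat -!catA; apply.
  rewrite (tangle_cat _ _ k1); have := tangle_frame l' r' hx.
  by rewrite -!catA.
have := tangle_frame l' r' hy; rewrite -!catA => hy'.
by rewrite (tangle_cat _ _ hy').
Qed.

Section DiskRelations.
Variables (n : nat) (R : seq oslice -> ratfun).
Hypothesis hR : MOY_polynomial n R.

Lemma circle_scale d :
  tangle_scale R [::] [::] [:: (OCup d, 0); (OCap, 0)] (qint n%:Z) [::].
Proof.
have h : tangle [::] [:: (OCup d, 0); (OCap, 0)] [::] by case: d.
split=> // l r o1 o2 k1 k2; rewrite /= !addn0.
apply: (moy_circle hR); apply: tangle_close k1 _ k2.
by have := tangle_frame l r h; rewrite /= addn0.
Qed.

Lemma loop_right_scale d : tangle_scale R [:: d] [:: d]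
  [:: (OCup d, 1); (OVert d d, 0); (OCap, 1)] (qint (n%:Z - 1)) [::].
Proof.
have h : tangle [:: d] [:: (OCup d, 1); (OVert d d, 0); (OCap, 1)] [:: d].
  by case: d.
split=> //; first by rewrite tangle_nil.
move=> l r o1 o2 k1 k2; rewrite /= !addn0 addn1.
apply: (moy_loop_right hR); apply: tangle_close k1 _ k2.
by have := tangle_frame l r h; rewrite /= addn0 addn1.
Qed.

Lemma loop_left_scale d : tangle_scale R [:: d] [:: d]
  [:: (OCup (~~ d), 0); (OVert d d, 1); (OCap, 0)] (qint (n%:Z - 1)) [::].
Proof.
have h : tangle [:: d] [:: (OCup (~~ d), 0); (OVert d d, 1); (OCap, 0)] [:: d].
  by case: d.
split=> //; first by rewrite tangle_nil.
move=> l r o1 o2 k1 k2; rewrite /= !addn0 addn1.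
apply: (moy_loop_left hR); apply: tangle_close k1 _ k2.
by have := tangle_frame l r h; rewrite /= addn0 addn1.
Qed.

Lemma parallel_scale d : tangle_scale R [:: d; d] [:: d; d]
  [:: (OVert d d, 0); (OVert d d, 0)] (qint 2) [:: (OVert d d, 0)].
Proof.
have h : tangle [:: d; d] [:: (OVert d d, 0); (OVert d d, 0)] [:: d; d].
  by case: d.
split=> //; first by clear h; case: d.
move=> l r o1 o2 k1 k2; rewrite /= !addn0.
apply: (moy_bigon_parallel hR); apply: tangle_close k1 _ k2.
by have := tangle_frame l r h; rewrite /= addn0.
Qed.

(** The loop relations are given for a vertex with parallel strands only.  A
    quarter turn of the vertex, followed by a change of heights of the two
    minima, brings a loop below the vertex into that position. *)
Lemma cup_loop_scale d : tangle_scale R [::] [:: ~~ d; d]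
  [:: (OCup d, 0); (OVert (~~ d) d, 0)] (qint (n%:Z - 1)) [:: (OCup (~~ d), 0)].
Proof.
have e1 : tangle_equiv R [:: d; ~~ d] [:: ~~ d; d] [:: (OVert (~~ d) d, 0)]
    [:: (OCup (~~ d), 2); (OVert (~~ d) (~~ d), 1); (OCap, 0)].
  by apply: tangle_equiv_sym; apply: (rotatel_equiv hR); case: d.
have e2 : tangle_equiv R [::] [:: d; ~~ d; ~~ d; d]
    [:: (OCup d, 0); (OCup (~~ d), 2)] [:: (OCup (~~ d), 0); (OCup d, 0)].
  by clear e1; apply: (tangle_equiv_move hR);
    [exact: (move_exchange Cup Cup 0 0)|..]; case: d.
have h1 : tangle [::] [:: (OCup d, 0)] [:: d; ~~ d] by clear e1 e2; case: d.
have h2 : tangle [:: d; ~~ d; ~~ d; d] [:: (OVert (~~ d) (~~ d), 1); (OCap, 0)]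
    [:: ~~ d; d]
  by clear e1 e2 h1; case: d.
apply: (tangle_equiv_scale (tangle_equiv_catl h1 e1)).
apply: (tangle_equiv_scale (tangle_equiv_cat e2 (tangle_equiv_refl R h2))).
have h3 : tangle [::] [:: (OCup (~~ d), 0)] ([::] ++ [:: ~~ d] ++ [:: d]).
  by clear e1 e2 h1 h2; case: d.
have h4 : tangle ([::] ++ [:: ~~ d] ++ [:: d]) [::] [:: ~~ d; d].
  by rewrite tangle_nil.
by have := tangle_scale_context (loop_left_scale (~~ d)) h3 h4; rewrite negbK.
Qed.

(** As for [cup_loop_scale], with the two maxima changing heights. *)
Lemma cap_loop_scale d : tangle_scale R [:: d; ~~ d] [::]
  [:: (OVert (~~ d) d, 0); (OCap, 0)] (qint (n%:Z - 1)) [:: (OCap, 0)].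
Proof.
have e1 : tangle_equiv R [:: d; ~~ d] [:: ~~ d; d] [:: (OVert (~~ d) d, 0)]
    [:: (OCup (~~ d), 2); (OVert (~~ d) (~~ d), 1); (OCap, 0)].
  by apply: tangle_equiv_sym; apply: (rotatel_equiv hR); case: d.
have e2 : tangle_equiv R [:: d; ~~ d; ~~ d; d] [::]
    [:: (OCap, 0); (OCap, 0)] [:: (OCap, 2); (OCap, 0)].
  by clear e1; apply: (tangle_equiv_move hR);
    [exact: (move_exchange Cap Cap 0 0)|..]; case: d.
have h1 : tangle [:: ~~ d; d] [:: (OCap, 0)] [::] by clear e1 e2; case: d.
have h2 : tangle [:: d; ~~ d] [:: (OCup (~~ d), 2); (OVert (~~ d) (~~ d), 1)]
    [:: d; ~~ d; ~~ d; d]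
  by clear e1 e2 h1; case: d.
apply: (tangle_equiv_scale (tangle_equiv_cat e1 (tangle_equiv_refl R h1))).
apply: (tangle_equiv_scale (tangle_equiv_catl h2 e2)).
have h3 : tangle [:: d; ~~ d] [::] ([:: d] ++ [:: ~~ d] ++ [::]).
  by rewrite tangle_nil.
have h4 : tangle ([:: d] ++ [:: ~~ d] ++ [::]) [:: (OCap, 0)] [::].
  by clear e1 e2 h1 h2 h3; case: d.
exact: (tangle_scale_context (loop_right_scale (~~ d)) h3 h4).
Qed.

End DiskRelations.

(** The relations of R become relations of the bracket once the difference z of
    the rotation numbers is read off from the turnings in the disk. *)
Section BracketInDisk.
Variables (n : nat) (R : seq oslice -> ratfun).
Hypothesis hR : MOY_polynomial n R.
Variables (s t l r : seq bool) (o1 o2 : seq oslice).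
Hypotheses (k1 : tangle [::] o1 (l ++ s ++ r))
           (k2 : tangle (l ++ t ++ r) o2 [::]).

Let W : ratfun := (q ^ (1 - n%:Z))%R.
Let f (p : seq oslice) := crossing_bracket n R (o1 ++ embed (size l) p ++ o2).

Lemma weight_rotnum p p' z : tangle s p t -> tangle s p' t ->
  (turning s p = turning s p' + z *+ 2)%R ->
  (W ^ rotnum (o1 ++ embed (size l) p ++ o2)
   = W ^ z * W ^ rotnum (o1 ++ embed (size l) p' ++ o2))%R.
Proof.
move=> h h' turn; rewrite (rotnum_disk h h' k1 k2 turn) expfzDr 1?mulrC //.
by rewrite expfz_neq0 ?q_neq0.
Qed.

Lemma bracket_scale p c p' z : tangle_scale R s t p c p' ->
  (turning s p = turning s p' + z *+ 2)%R -> (f p = c * W ^ z * f p')%R.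
Proof.
case=> h h' e turn.
rewrite /f /crossing_bracket (weight_rotnum h h' turn) (e l r) // -/W.
by rewrite mulrACA [(c * _)%R]mulrC -!mulrA; congr (_ * _)%R; rewrite mulrCA.
Qed.

End BracketInDisk.

Lemma bracket_antiparallel n R d l r o1 o2 : MOY_polynomial n R ->
  tangle [::] o1 (l ++ [:: d; ~~ d] ++ r) ->
  tangle (l ++ [:: d; ~~ d] ++ r) o2 [::] ->
  let f p := crossing_bracket n R (o1 ++ embed (size l) p ++ o2) in
  (f [:: (OVert (~~ d) d, 0); (OVert d (~~ d), 0)]
   = f [::] + qint (n%:Z - 2) * (q ^ (1 - n%:Z)) ^ (- twist d)
              * f [:: (OCap, 0); (OCup d, 0)])%R.
Proof.
move=> hR k1 k2 /=; rewrite !addn0.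
have h : tangle [:: d; ~~ d] [:: (OVert (~~ d) d, 0); (OVert d (~~ d), 0)]
    [:: d; ~~ d] by case: d {k1 k2}.
have h0 : tangle [:: d; ~~ d] [::] [:: d; ~~ d] by rewrite tangle_nil.
have hU : tangle [:: d; ~~ d] [:: (OCap, 0); (OCup d, 0)] [:: d; ~~ d].
  by case: d {k1 k2 h h0}.
have w0 := @weight_rotnum n _ _ _ _ _ _ k1 k2 _ _ 0%R h h0.
have wU := @weight_rotnum n _ _ _ _ _ _ k1 k2 _ _ (- twist d)%R h hU.
rewrite /crossing_bracket.
have := @moy_bigon_antiparallel n R hR o1 o2 (size l) (~~ d).
rewrite negbK /= => ->; last first.
  by have := tangle_close k1 (tangle_frame l r h) k2; rewrite /= addn0.
rewrite mulrDr; congr (_ + _)%R.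
  move: w0; rewrite /= !addn0 expr0z mul1r => -> //.
  by clear; case: d.
move: wU; rewrite /= !addn0 => ->; last by clear; case: d.
by ring.
Qed.

Lemma tangle_sum_list s t w f vs :
  [seq v.2 | v <- states s w & v.1 == t] = vs ->
  tangle_sum s t w f = (\sum_(e <- vs) q ^ e.1 * f e.2)%R.
Proof. by move=> <-; rewrite big_map big_filter. Qed.

(** * The bigon relation *)

Lemma states_smoothing d f :
  let U := [:: (OCap, 0); (OCup d, 0)] in
  let A := [:: (OVert (~~ d) d, 0); (OVert d (~~ d), 0)] in
  let S w := tangle_sum [:: d; ~~ d] [:: d; ~~ d] w f in
  [/\ S [:: (Vert, 0); (Vert, 0)]
      = ((q ^ twist d) ^- 2 * f [::] + 2%:R * f U
         + (q ^ twist d) ^+ 2 * f (U ++ U) + f A)%R,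
      S [:: (Vert, 0)] = ((q ^ twist d)^-1 * f [::] + q ^ twist d * f U)%R
    & S [:: (Cap, 0); (Cup, 0)] = f U].
Proof.
case: d => /=; rewrite ?expr1z ?exprN1 ?invrK ?exprVn ?invrK; split.
- rewrite (@tangle_sum_list _ _ _ _
    [:: (2, [::]); (0, [:: (OCap, 0); (OCup true, 0)]);
        (0, [:: (OCap, 0); (OCup true, 0)]);
        (-2, [:: (OCap, 0); (OCup true, 0); (OCap, 0); (OCup true, 0)]);
        (0, [:: (OVert false true, 0); (OVert true false, 0)])]%R) //.
  rewrite !big_cons big_nil /= expr0z !mul1r addr0 mulr_natl !addrA.
  by rewrite -[(q ^ 2)%R]/(q ^+ 2)%R -[(q ^ (-2))%R]/((q ^+ 2)^-1)%R.
- rewrite (@tangle_sum_list _ _ _ _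
    [:: (1, [::]); (-1, [:: (OCap, 0); (OCup true, 0)])]%R) //.
  by rewrite !big_cons big_nil /= addr0.
- rewrite (@tangle_sum_list _ _ _ _ [:: (0, [:: (OCap, 0); (OCup true, 0)])]%R) //.
  by rewrite big_seq1 mul1r.
- rewrite (@tangle_sum_list _ _ _ _
    [:: (0, [:: (OVert true false, 0); (OVert false true, 0)]);
        (2, [:: (OCap, 0); (OCup false, 0); (OCap, 0); (OCup false, 0)]);
        (0, [:: (OCap, 0); (OCup false, 0)]);
        (0, [:: (OCap, 0); (OCup false, 0)]); (-2, [::])]%R) //.
  rewrite !big_cons big_nil /= expr0z !mul1r addr0.
  rewrite -[(q ^ 2)%R]/(q ^+ 2)%R -[(q ^ (-2))%R]/((q ^+ 2)^-1)%R.
  by ring.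
- rewrite (@tangle_sum_list _ _ _ _
    [:: (1, [:: (OCap, 0); (OCup false, 0)]); (-1, [::])]%R) //.
  by rewrite !big_cons big_nil /= addr0 addrC.
- rewrite (@tangle_sum_list _ _ _ _ [:: (0, [:: (OCap, 0); (OCup false, 0)])]%R) //.
  by rewrite big_seq1 mul1r.
Qed.

Lemma states_crossing d f :
  let X := [:: (OVert (~~ d) d, 0)] in
  let S w := tangle_sum [:: d; ~~ d] [:: ~~ d; d] w f in
  [/\ S [:: (Vert, 0); (Vert, 0)]
      = ((q ^ twist d)^-1 * f X
         + q ^ twist d * f ([:: (OCap, 0); (OCup d, 0)] ++ X)
         + (q ^ twist d)^-1 * f (X ++ [:: (OCap, 0); (OCup (~~ d), 0)])
         + q ^ twist d * f X)%R,
      S [:: (Vert, 0)] = f X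
    & S [:: (Cap, 0); (Cup, 0)] = f [:: (OCap, 0); (OCup (~~ d), 0)]].
Proof.
case: d => /=; rewrite ?expr1z ?exprN1 ?invrK; split.
- rewrite (@tangle_sum_list _ _ _ _
    [:: (1, [:: (OVert false true, 0)]);
        (-1, [:: (OCap, 0); (OCup true, 0); (OVert false true, 0)]);
        (1, [:: (OVert false true, 0); (OCap, 0); (OCup false, 0)]);
        (-1, [:: (OVert false true, 0)])]%R) //.
  by rewrite !big_cons big_nil /= addr0 !addrA.
- rewrite (@tangle_sum_list _ _ _ _ [:: (0, [:: (OVert false true, 0)])]%R) //.
  by rewrite big_seq1 mul1r.
- rewrite (@tangle_sum_list _ _ _ _ [:: (0, [:: (OCap, 0); (OCup false, 0)])]%R) //.
  by rewrite big_seq1 mul1r.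
- rewrite (@tangle_sum_list _ _ _ _
    [:: (1, [:: (OVert true false, 0)]);
        (-1, [:: (OVert true false, 0); (OCap, 0); (OCup true, 0)]);
        (1, [:: (OCap, 0); (OCup false, 0); (OVert true false, 0)]);
        (-1, [:: (OVert true false, 0)])]%R) //.
  by rewrite !big_cons big_nil /= addr0 expr1z exprN1; ring.
- rewrite (@tangle_sum_list _ _ _ _ [:: (0, [:: (OVert true false, 0)])]%R) //.
  by rewrite big_seq1 mul1r.
- rewrite (@tangle_sum_list _ _ _ _ [:: (0, [:: (OCap, 0); (OCup true, 0)])]%R) //.
  by rewrite big_seq1 mul1r.
Qed.

(** With x = q ^ twist d, w and v the rotation weights, and a and u the brackets
    of the vertical and horizontal arcs. *)
Lemma smoothing_identity (F : fieldType) (x w v k k' a u : F) : (x != 0)%R ->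
  (x ^- 2 * a + 2%:R * u + x ^+ 2 * (k * w * u) + (a + k' * v * u)
   = (x ^+ 2 * (k * w) + 2%:R + k' * v - (x + x^-1) * x) * u
     + (x + x^-1) * (x^-1 * a + x * u))%R.
Proof. by move=> x0; field. Qed.

Lemma crossing_identity (F : fieldType) (x w v k a u : F) :
  (x^-1 * a + x * (k * w * u) + x^-1 * (k * v * u) + x * a
   = (x * (k * w) + x^-1 * (k * v)) * u + (x + x^-1) * a)%R.
Proof. by ring. Qed.

Definition bigon_relation (n : nat) (s t : seq bool) (f : seq oslice -> ratfun) :=
  let S w := tangle_sum s t w f in
  (S [:: (Vert, 0); (Vert, 0)]
   = (qint ((2 * n)%:Z - 3) + 1) * S [:: (Cap, 0); (Cup, 0)]
     + qint 2 * S [:: (Vert, 0)])%R.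

Section BigonRelation.
Variables (n : nat) (R : seq oslice -> ratfun).
Hypothesis hR : MOY_polynomial n R.
Variables (l r : seq bool) (o1 o2 : seq oslice).
Let f p := crossing_bracket n R (o1 ++ embed (size l) p ++ o2).

Lemma bigon_parallel d : tangle [::] o1 (l ++ [:: d; d] ++ r) ->
  tangle (l ++ [:: d; d] ++ r) o2 [::] -> bigon_relation n [:: d; d] [:: d; d] f.
Proof.
move=> k1 k2; rewrite /bigon_relation.
rewrite (@tangle_sum_list _ _ [:: (Vert, 0); (Vert, 0)] f
  [:: (0%R, [:: (OVert d d, 0); (OVert d d, 0)])]); last by clear; case: d.
rewrite (@tangle_sum_list _ _ [:: (Cap, 0); (Cup, 0)] f [::]); last by clear; case: d.
rewrite (@tangle_sum_list _ _ [:: (Vert, 0)] f [:: (0%R, [:: (OVert d d, 0)])]);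
  last by clear; case: d.
rewrite !big_seq1 big_nil mulr0 add0r !expr0z !mul1r.
rewrite [LHS](bracket_scale n k1 k2 (parallel_scale hR d) (z := 0)).
  by rewrite expr0z mulr1.
by clear; case: d.
Qed.

Lemma bigon_smoothing d : tangle [::] o1 (l ++ [:: d; ~~ d] ++ r) ->
  tangle (l ++ [:: d; ~~ d] ++ r) o2 [::] ->
  bigon_relation n [:: d; ~~ d] [:: d; ~~ d] f.
Proof.
move=> k1 k2; rewrite /bigon_relation.
have [-> -> ->] := states_smoothing d f.
set U := [:: (OCap, 0); _]; set A := [:: (OVert _ _, 0); _].
have eA : f A = _ := bracket_antiparallel hR k1 k2.
have cU : tangle_scale R [:: d; ~~ d] [:: d; ~~ d] (U ++ U) (qint n%:Z) U.
  have h1 : tangle [:: d; ~~ d] [:: (OCap, 0)] ([::] ++ [::] ++ [::]).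
    by clear; case: d.
  have h2 : tangle ([::] ++ [::] ++ [::]) [:: (OCup d, 0)] [:: d; ~~ d].
    by clear; case: d.
  exact: (tangle_scale_context (circle_scale hR d) h1 h2).
have eC : (f (U ++ U) = qint n%:Z * (q ^ (1 - n%:Z)) ^ twist d * f U)%R.
  by apply: (bracket_scale n k1 k2 cU); rewrite /U; clear; case: d.
rewrite eC eA -invr_expz.
have /= E := circle_coefficient n d.
rewrite -(addrK (qint 2 * q ^ twist d)%R (qint _ + 1)%R) -{}E.
rewrite (qint_two_twist d); apply: smoothing_identity.
by rewrite expfz_neq0 ?q_neq0.
Qed.

Lemma bigon_crossing d : tangle [::] o1 (l ++ [:: d; ~~ d] ++ r) ->
  tangle (l ++ [:: ~~ d; d] ++ r) o2 [::] ->
  bigon_relation n [:: d; ~~ d] [:: ~~ d; d] f.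
Proof.
move=> k1 k2; rewrite /bigon_relation.
have [-> -> ->] := states_crossing d f.
set X := [:: (OVert _ _, 0)]; set Y := [:: (OCap, 0); (OCup (~~ d), 0)].
have s1 : tangle_scale R [:: d; ~~ d] [:: ~~ d; d]
    ([:: (OCap, 0); (OCup d, 0)] ++ X) (qint (n%:Z - 1)) Y.
  have h1 : tangle [:: d; ~~ d] [:: (OCap, 0)] ([::] ++ [::] ++ [::]).
    by clear; case: d.
  have h2 : tangle ([::] ++ [:: ~~ d; d] ++ [::]) [::] [:: ~~ d; d].
    by rewrite tangle_nil.
  exact: (tangle_scale_context (cup_loop_scale hR d) h1 h2).
have s2 : tangle_scale R [:: d; ~~ d] [:: ~~ d; d] (X ++ Y) (qint (n%:Z - 1)) Y.
  have h1 : tangle [:: d; ~~ d] [::] ([::] ++ [:: d; ~~ d] ++ [::]).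
    by rewrite tangle_nil.
  have h2 : tangle ([::] ++ [::] ++ [::]) [:: (OCup (~~ d), 0)] [:: ~~ d; d].
    by clear; case: d.
  exact: (tangle_scale_context (cap_loop_scale hR d) h1 h2).
have e1 : f ([:: (OCap, 0); (OCup d, 0)] ++ X)
    = (qint (n%:Z - 1) * (q ^ (1 - n%:Z)) ^ twist d * f Y)%R.
  by apply: (bracket_scale n k1 k2 s1); rewrite /X /Y; clear; case: d.
have e2 : f (X ++ Y)
    = (qint (n%:Z - 1) * (q ^ (1 - n%:Z)) ^ (- twist d) * f Y)%R.
  by apply: (bracket_scale n k1 k2 s2); rewrite /X /Y; clear; case: d.
rewrite e1 e2 -(loop_coefficient n d) (qint_two_twist d) -invr_expz /=.
exact: crossing_identity.
Qed.

(** No state exists unless as many strands go up below as above the disk; this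
    leaves the directions of the three lemmas above. *)
Lemma bigon_boundary s t : size s = 2 -> size t = 2 ->
  tangle [::] o1 (l ++ s ++ r) -> tangle (l ++ t ++ r) o2 [::] ->
  bigon_relation n s t f.
Proof.
case: s => [|a [|b [|]]] // _; case: t => [|c [|d [|]]] // _.
have empty : 
    [seq v.2 | v <- states [:: a; b] [:: (Vert, 0); (Vert, 0)] & v.1 == [:: c; d]]
      = [::] ->
    [seq v.2 | v <- states [:: a; b] [:: (Vert, 0)] & v.1 == [:: c; d]]
      = [::] ->
    [seq v.2 | v <- states [:: a; b] [:: (Cap, 0); (Cup, 0)] & v.1 == [:: c; d]]
      = [::] ->
    bigon_relation n [:: a; b] [:: c; d] f.
  move=> h1 h2 h3; rewrite /bigon_relation.
  by rewrite !(tangle_sum_list _ h1, tangle_sum_list _ h2, tangle_sum_list _ h3)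
     big_nil !mulr0 addr0.
by case: a empty => empty; case: b empty => empty; case: c empty => empty;
   case: d empty => empty k1 k2;
   by [apply: empty | exact: bigon_parallel k1 k2 |
       exact: (@bigon_smoothing true) | exact: (@bigon_smoothing false) |
       exact: (@bigon_crossing true) | exact: (@bigon_crossing false)].
Qed.

End BigonRelation.

Theorem proposition3 (n : nat) (hn : 2 <= n)
    (R : seq oslice -> ratfun) (hR : MOY_polynomial n R)
    (a b : seq slice) (i : nat)
    (hbigon : planar_graph (a ++ [:: (Vert, i); (Vert, i)] ++ b))
    (G Gs Gx : seq slice)
    (hG : isotopic G (a ++ [:: (Vert, i); (Vert, i)] ++ b))
    (hGs : isotopic Gs (a ++ [:: (Cap, i); (Cup, i)] ++ b))
    (hGx : isotopic Gx (a ++ [:: (Vert, i)] ++ b)) :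
  (evaluation n R G =
     (qint ((2 * n)%:Z - 3) + 1) * evaluation n R Gs
     + qint 2 * evaluation n R Gx)%R.
Proof.
rewrite (evaluation_isotopic hR hG) (evaluation_isotopic hR hGs).
rewrite (evaluation_isotopic hR hGx).
have [m [ha]] := width_run_local hbigon.
rewrite /= /width_step /=; case: ifP => // fit _.
have := @local_relation n R 2 2 [:: (Vert, 0); (Vert, 0)] [:: (Cap, 0); (Cup, 0)]
  [:: (Vert, 0)] (qint ((2 * n)%:Z - 3) + 1)%R (qint 2) erefl erefl erefl.
move=> /(_ _ a b i m ha fit); rewrite /= addn0; apply.
by move=> s t l r o1 o2 ss st k1 k2; apply: bigon_boundary k1 k2.
Qed.
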